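(* Let $x\in(0,1)$ be non-dyadic and let $h$ be the harmonic function on $\Omega_x$ with boundary values $h(q_0)=a$ and $h|_{S(x)}=f$, where $f=b+\sum_\omega c_\omega\psi_\omega$ with $c_\omega=\int_{S(x)}f\psi_\omega\,d\mu$. Then the normal derivative $\partial_n h$ on $S(x)$ is given by $$2(b-a)\left(\tfrac{5}{3}\right)^{n_1}(1-m_0(x))+\sum_{m=0}^\infty\sum_{|\omega|=m}6\cdot 2^m\left(\tfrac{5}{3}\right)^{n_{m+1}}\left(\frac{1-m_0(y_m)}{2m_0(y_m)+1}\right)c_\omega\psi_\omega .$$ In other words, the Dirichlet-to-Neumann map $f\mapsto\partial_n h$ is a Haar series multiplier map with multiplier $6\cdot 2^m\left(\frac53\right)^{n_{m+1}}\left(\frac{1-m_0(y_m)}{2m_0(y_m)+1}\right)$ on $\psi_\omega$, $|\omega|=m$.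
   Context: Let $q_0,q_1,q_2$ be the vertices of an equilateral triangle of height $1$ in the plane, $q_0$ on top and $q_1q_2$ horizontal; $F_i(p)=(p+q_i)/2$; $\mathcal{SG}$ is the Sierpinski gasket, i.e. the attractor of $F_0,F_1,F_2$. Products and powers of the $F_i$ are compositions. Let $x\in(0,1)$ be not a dyadic rational, written uniquely as $x=\sum_{k\ge1}2^{-n_k}$ with integers $0<n_1<n_2<\cdots$ (infinite sequence); put $n_0=0$. Let $L_x$ be the horizontal line at distance $x$ below $q_0$, $\Omega_x$ the set of points of $\mathcal{SG}$ strictly above $L_x$, and $S(x)=\mathcal{SG}\cap L_x$ (a Cantor set). The boundary of $\Omega_x$ is $\{q_0\}\cup S(x)$. A function on $\Omega_x$ is harmonic if $\Delta h=0$ on $\Omega_x\setminus\{q_0\}$, $\Delta$ the standard Kigami Laplacian. Put $Rx=x-2^{-n_1}$ and $y_m=2^{n_m}R^mx=\sum_{k>m}2^{-(n_k-n_m)}$ (so $y_0=x$). The function $m_0$ satisfies $m_0(x)=\dfrac{1}{1+2(5/3)^{n_2-n_1}(1-m_0(Rx))}$ and is defined as $m_0(x)=\lim_k m_0^{(k)}(x)$, where $m_0^{(k)}(x)=t_1$ with $t_k=0$ and $t_j=\left(1+2(5/3)^{n_{j+1}-n_j}(1-t_{j+1})\right)^{-1}$ for $1\le j<k$. For a word $\omega=(\omega_1,\dots,\omega_m)$ with $\omega_j\in\{1,2\}$, $|\omega|=m\ge0$, put $\tilde F_\omega=F_0^{n_1-1}F_{\omega_1}F_0^{n_2-n_1-1}F_{\omega_2}\cdots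 F_0^{n_m-n_{m-1}-1}F_{\omega_m}$ ($\tilde F_\emptyset=\mathrm{id}$) and $S_\omega(x)=S(x)\cap\tilde F_\omega(\mathcal{SG})$. The Cantor measure $\mu$ is the probability measure on $S(x)$ with $\mu(S_\omega(x))=2^{-|\omega|}$. The Haar function $\psi_\omega$ is supported on $S_\omega(x)$, equals $2^{m/2}$ on $S_{\omega1}(x)$ and $-2^{m/2}$ on $S_{\omega2}(x)$. $h_0$ is the harmonic function, continuous on $\Omega_x\cup S(x)$, with $h_0(q_0)=1$, $h_0|_{S(x)}=0$; $h_\omega$ is the one with $h_\omega(q_0)=0$, $h_\omega|_{S(x)}=\psi_\omega$. The harmonic function with boundary values $a$ at $q_0$ and $f=b+\sum_\omega c_\omega\psi_\omega$ on $S(x)$ is $h=ah_0+b(1-h_0)+\sum_{m\ge0}\sum_{|\omega|=m}c_\omega h_\omega$ (at each point of $\Omega_x$ only finitely many terms are nonzero). Normal derivatives: at the top vertex of $\tilde F_\omega(\mathcal{SG})$, $|\omega|=m$, $\partial_n u(\tilde F_\omega q_0)=\lim_{k\to\infty}(5/3)^{n_m+k}\left(2u(\tilde F_\omega q_0)-u(\tilde F_\omega F_0^kq_1)-u(\tilde F_\omega F_0^kq_2)\right)$ (taken within the cell $\tilde F_\omega(\mathcal{SG})$). On $S(x)$, $$\partial_n u|_{S(x)}=\lim_{m\to\infty}2^m\sum_{|\omega|=m}\left(-\partial_n u(\tilde F_\omega q_0)\right)\chi_{S_\omega(x)}$$ if the limit exists. This limit and the sum over $m$ of the Haar series (grouped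 by word length) are taken in the same mode of convergence (e.g. pointwise almost everywhere or in $L^2(S(x),\mu)$), $\partial_n h$ being defined when the limit exists. *)

(* Defs.v *)
From HB Require Import structures.
From mathcomp Require Import all_boot all_order all_algebra.
From mathcomp Require Import all_classical all_reals all_analysis.

Set Implicit Arguments.
Unset Strict Implicit.
Unset Printing Implicit Defensive.

Import Order.TTheory GRing.Theory Num.Theory.
Import numFieldNormedType.Exports.

Local Open Scope classical_set_scope.
Local Open Scope ring_scope.

(* The plane carries the product topology and the Borel (product) sigma-algebra
   of the canonical structures on pairs. *)
Notation plane R := (R * R)%type.

(* Equilateral triangle of height 1 (side 2 / sqrt 3), q 0 on top. *)
Definition q {R : realType} (i : 'I_3) : plane R :=
  match val i with
  | 0 => (0, 1)
  | 1 => (- (Num.sqrt 3)^-1, 0)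
  | _ => ((Num.sqrt 3)^-1, 0)
  end.

Definition F {R : realType} (i : 'I_3) (p : plane R) : plane R :=
  ((p.1 + (q i).1) / 2, (p.2 + (q i).2) / 2).

(* Self-similar sets are characterized by Hutchinson's theorem as the unique
   nonempty compact set with K = F_0 K `|` F_1 K `|` F_2 K. *)
Definition is_gasket {R : realType} (K : set (plane R)) : Prop :=
  [/\ K !=set0, compact K & K = \bigcup_(i : 'I_3) (F i @` K)].

Definition Fword {R : realType} (w : seq 'I_3) : plane R -> plane R :=
  foldr (fun i g => F i \o g) id w.

Definition vertices {R : realType} (m : nat) : set (plane R) :=
  [set p | exists (w : m.-tuple 'I_3) (i : 'I_3), p = Fword w (q i)].

(* Neighbours of p in the level-m graph: the other vertices of the m-cells
   having p as a vertex. *)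
Definition neighbours {R : realType} (m : nat) (p : plane R) : set (plane R) :=
  [set p' | p' <> p /\
    exists (w : m.-tuple 'I_3) (i j : 'I_3), p = Fword w (q i) /\ p' = Fword w (q j)].

Definition graph_laplacian {R : realType} (m : nat) (u : plane R -> R)
    (p : plane R) : R :=
  \sum_(p' \in neighbours m p) (u p' - u p).

(* Kigami Laplacian, in its pointwise formulation, on a relatively open subset U
   of the gasket minus its three corners: u is continuous on U and
   (3/2) 5^m Delta_m u converges to the continuous function f, uniformly on
   the level-m vertices lying in any compact subset of U. *)
Definition is_laplacian {R : realType} (U : set (plane R)) (u f : plane R -> R) : Prop :=
  [/\ {within U, continuous u}, {within U, continuous f} &
      forall K : set (plane R), compact K -> K `<=` U ->
      forall e : R, 0 < e ->
      \forall m \near \oo, forall p, vertices m p -> K p ->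
        `|3 / 2 * 5 ^+ m * graph_laplacian m u p - f p| <= e].

Definition harmonic {R : realType} (U : set (plane R)) (u : plane R -> R) : Prop :=
  is_laplacian U u (cst 0).

Definition depth {R : realType} (p : plane R) : R := (q ord0).2 - p.2.

Definition Omega {R : realType} (SG : set (plane R)) (x : R) : set (plane R) :=
  [set p | SG p /\ depth p < x].

Definition Sx {R : realType} (SG : set (plane R)) (x : R) : set (plane R) :=
  [set p | SG p /\ depth p = x].

Definition nondyadic {R : realType} (x : R) : Prop :=
  forall k j : nat, x != k%:R / 2 ^+ j.

Definition is_binary_exponents {R : realType} (x : R) (n : nat -> nat) : Prop :=
  [/\ n 0 = 0%N, (forall k, (n k < n k.+1)%N) &
      series (fun k => 2 ^- n k.+1 : R) @ \oo --> x].

(* expo x k is n_k; for nondyadic x in (0,1) the sequence is unique. *)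
Definition expo {R : realType} (x : R) : nat -> nat :=
  get [set n | is_binary_exponents x n].

Definition drop_leading {R : realType} (x : R) : R := x - 2 ^- expo x 1.

(* 2^(n_m) R^m x = sum over k > m of 2^-(n_k - n_m), where R x = x - 2^(-n_1). *)
Definition y_ {R : realType} (x : R) (m : nat) : R :=
  2 ^+ expo x m * iter m drop_leading x.

(* For d = k - j this is t_j in the backward recursion started at t_k = 0. *)
Fixpoint m0_rec {R : realType} (n : nat -> nat) (d j : nat) : R :=
  if d is d'.+1 then
    (1 + 2 * (5 / 3) ^+ (n j.+1 - n j) * (1 - m0_rec n d' j.+1))^-1
  else 0.

Definition m0 {R : realType} (x : R) : R :=
  limn (fun k => m0_rec (expo x) k.-1 1 : R).

(* Letters 1, 2 are encoded by 'I_2, embedded in 'I_3 by i |-> i + 1. *)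
Definition letter (i : 'I_2) : 'I_3 := lift ord0 i.
Definition letter1 : 'I_2 := ord0.
Definition letter2 : 'I_2 := ord_max.

(* F0^(n_(k+1) - n_k - 1) F_(w_1) F0^(n_(k+2) - n_(k+1) - 1) F_(w_2) ... *)
Fixpoint tF_from {R : realType} (n : nat -> nat) (k : nat) (w : seq 'I_2) :
    plane R -> plane R :=
  if w is i :: w' then
    iter (n k.+1 - n k).-1 (F ord0) \o F (letter i) \o tF_from n k.+1 w'
  else id.

Definition tF {R : realType} (x : R) (w : seq 'I_2) : plane R -> plane R :=
  tF_from (expo x) 0 w.

Definition Sw {R : realType} (SG : set (plane R)) (x : R) (w : seq 'I_2) : set (plane R) :=
  Sx SG x `&` (tF x w @` SG).

Definition is_cantor_measure {R : realType} (SG : set (plane R)) (x : R)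
    (mu : probability (plane R) R) : Prop :=
  mu (Sx SG x) = 1%E /\
  forall w : seq 'I_2, mu (Sw SG x w) = (2 ^- size w)%:E.

Definition haar {R : realType} (SG : set (plane R)) (x : R) (w : seq 'I_2)
    (p : plane R) : R :=
  Num.sqrt (2 ^+ size w) *
    (\1_(Sw SG x (rcons w letter1)) p - \1_(Sw SG x (rcons w letter2)) p).

Definition haar_coef {R : realType} (SG : set (plane R)) (x : R)
    (mu : probability (plane R) R) (f : plane R -> R) (w : seq 'I_2) : R :=
  \int[mu]_(p in Sx SG x) (f p * haar SG x w p).

Definition haar_sum {R : realType} (SG : set (plane R)) (x : R) (b : R)
    (c : seq 'I_2 -> R) (M : nat) (p : plane R) : R :=
  b + \sum_(m < M) \sum_(w : m.-tuple 'I_2) c w * haar SG x w p.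

(* A mode of convergence of sequences of functions on A: a relation between
   sequences and limits which only sees the values on A. *)
Definition convergence_mode {R : realType} (A : set (plane R))
    (conv : (nat -> plane R -> R) -> (plane R -> R) -> Prop) : Prop :=
  forall (u v : nat -> plane R -> R) (g k : plane R -> R),
    (forall n p, A p -> u n p = v n p) -> (forall p, A p -> g p = k p) ->
    conv u g -> conv v k.

Definition cvg_ae {R : realType} (mu : probability (plane R) R) (A : set (plane R))
    (u : nat -> plane R -> R) (g : plane R -> R) : Prop :=
  {ae mu, forall p, A p -> u ^~ p @ \oo --> g p}.

Definition cvg_L2 {R : realType} (mu : probability (plane R) R) (A : set (plane R))
    (u : nat -> plane R -> R) (g : plane R -> R) : Prop :=
  [/\ measurable_fun A g, (\int[mu]_(p in A) ((g p) ^+ 2)%:E < +oo)%E &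
      (fun n => \int[mu]_(p in A) ((u n p - g p) ^+ 2)%:E)%E @ \oo --> 0%E].

Lemma cvg_ae_mode (R : realType) (mu : probability (plane R) R) (A : set (plane R)) :
  convergence_mode A (cvg_ae mu A).
Proof.
move=> u v g k uv gk; apply: filterS => p ug Ap.
rewrite -gk//; have <- : u ^~ p = v ^~ p by apply/funext => n; exact: uv.
exact: ug.
Qed.

Lemma cvg_L2_mode (R : realType) (mu : probability (plane R) R) (A : set (plane R)) :
  convergence_mode A (cvg_L2 mu A).
Proof.
move=> u v g k uv gk [mg ig ug]; split.
- by apply: eq_measurable_fun mg => p /set_mem; exact: gk.
- rewrite (_ : (\int[mu]_(p in A) _)%E = (\int[mu]_(p in A) ((g p) ^+ 2)%:E)%E)//.
  by apply: eq_integral => p /set_mem Ap; rewrite gk.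
- rewrite (_ : (fun n => _) =
      (fun n => \int[mu]_(p in A) ((u n p - g p) ^+ 2)%:E)%E)//.
  apply/funext => n; apply: eq_integral => p /set_mem Ap.
  by rewrite gk// uv.
Qed.

Definition solves_dirichlet {R : realType} (SG : set (plane R)) (x : R) (a : R)
    (phi u : plane R -> R) : Prop :=
  [/\ harmonic (Omega SG x `\ q ord0) u,
      {within Omega SG x `|` Sx SG x, continuous u},
      u (q ord0) = a & forall p, Sx SG x p -> u p = phi p].

(* At each point of Omega only finitely many terms of the series are nonzero. *)
Definition harmonic_ext {R : realType} (h0 : plane R -> R)
    (hw : seq 'I_2 -> plane R -> R) (a b : R) (c : seq 'I_2 -> R) (p : plane R) : R :=
  a * h0 p + b * (1 - h0 p) +
  limn (fun M => \sum_(m < M) \sum_(w : m.-tuple 'I_2) c w * hw w p).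

Definition top_flux {R : realType} (x : R) (u : plane R -> R) (w : seq 'I_2) (k : nat) : R :=
  (5 / 3) ^+ (expo x (size w) + k) *
    (2 * u (tF x w (q ord0))
     - u (tF x w (iter k (F ord0) (q (letter letter1))))
     - u (tF x w (iter k (F ord0) (q (letter letter2))))).

Definition dn_top {R : realType} (x : R) (u : plane R -> R) (w : seq 'I_2) : R :=
  limn (top_flux x u w).

Definition dn_approx {R : realType} (SG : set (plane R)) (x : R) (u : plane R -> R)
    (m : nat) (p : plane R) : R :=
  2 ^+ m * \sum_(w : m.-tuple 'I_2) (- dn_top x u w) * \1_(Sw SG x w) p.

(* The sequences top_flux are the difference quotients at the tops of the cells;
   their limits and the limit in m must both exist. *)
Definition is_normal_derivative {R : realType} (SG : set (plane R)) (x : R)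
    (conv : (nat -> plane R -> R) -> (plane R -> R) -> Prop)
    (u g : plane R -> R) : Prop :=
  (forall w, cvgn (top_flux x u w)) /\ conv (dn_approx SG x u) g.

Definition dn_multiplier {R : realType} (x : R) (m : nat) : R :=
  6 * 2 ^+ m * (5 / 3) ^+ expo x m.+1 *
    ((1 - m0 (y_ x m)) / (2 * m0 (y_ x m) + 1)).

(* Main.v *)
Require Import Defs.
From HB Require Import structures.
From mathcomp Require Import all_boot all_order all_algebra.
From mathcomp Require Import all_classical all_reals all_analysis.
From mathcomp Require Import ring lra zify.

Import Order.TTheory GRing.Theory Num.Theory.
Import numFieldNormedType.Exports.

Local Open Scope classical_set_scope.
Local Open Scope ring_scope.

(* A solution u of a Dirichlet problem is determined, as far as normal
   derivatives on S(x) are concerned, by its values v_w at the tops of the cells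
   tF_w(SG). A function that is harmonic in the pointwise sense satisfies the
   graph Laplace equation exactly on every cell above the line, so by the 3/5
   scaling of normal derivatives the v_w satisfy Kirchhoff's equations on an
   infinite binary tree with conductances (5/3)^(n_m). Solutions on that tree
   are determined by the root value and by the limits along the branches, which
   are the boundary values. The solutions with the boundary values of h_0 and
   h_w are explicit: h_0 is the product of the m_0(y_l), because the functional
   equation of m_0 is Kirchhoff's equation for a symmetric solution, and h_w is
   antisymmetric between the two halves of its cell. Their fluxes through the
   cells of generation m show that the m-th approximation of the normal
   derivative equals, pointwise on S(x), the m-th partial sum of the
   asserted Haar series. *)

(** * Kirchhoff's equations on the binary tree *)

(** The top of a child cell lies in two triangles: one shared with its parent and sibling, of
    conductance [r (size w).+1], and one shared with its own children. [rev_ord] exchanges the two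
    letters; the root carries no equation. *)
Definition tree_harmonic {R : realType} (r : nat -> R) (v : seq 'I_2 -> R) : Prop :=
  forall w i,
    r (size w).+1 * (2 * v (rcons w i) - v w - v (rcons w (rev_ord i))) +
    r (size w).+2 * (2 * v (rcons w i) - v (rcons (rcons w i) letter1)
                     - v (rcons (rcons w i) letter2)) = 0.

Definition branch (W : nat -> seq 'I_2) : Prop :=
  forall k, exists i, W k.+1 = rcons (W k) i.

Lemma ord2P (i : 'I_2) : i = letter1 \/ i = letter2.
Proof. by case: i => -[|[|//]] ?; [left|right]; apply: val_inj. Qed.

Lemma rev_letter1 : rev_ord letter1 = letter2.
Proof. exact: val_inj. Qed.

Lemma rev_letter2 : rev_ord letter2 = letter1.
Proof. exact: val_inj. Qed.

(* If a child of a zero of [v] were positive, the branch that always moves to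
   the larger child would be nondecreasing: at a node dominating its parent and
   its sibling, the children have a mean value which is at least as large. *)
Lemma tree_harmonic_le0 {R : realType} (r : nat -> R) (v : seq 'I_2 -> R) :
  (forall k, 0 < r k) -> tree_harmonic r v ->
  (forall W, branch W -> v \o W @ \oo --> (0 : R)) ->
  forall w i, v w = 0 -> v (rcons w i) <= 0.
Proof.
move=> r0 hv limv w i vw0; rewrite leNgt; apply/negP => vi0.
have [j vj0 vjr] : exists2 j, 0 < v (rcons w j) & v (rcons w (rev_ord j)) <= v (rcons w j).
  have [ij|ij] := leP (v (rcons w (rev_ord i))) (v (rcons w i)).
    by exists i.
  exists (rev_ord i); first exact: lt_trans vi0 ij.
  by rewrite rev_ordK ltW.
pose nxt s := rcons s (if v (rcons s letter1) <= v (rcons s letter2)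
                       then letter2 else letter1).
pose W k := iter k nxt (rcons w j).
have brW : branch W by move=> k; rewrite /W iterS /nxt; eexists.
have inv k : exists s i', [/\ W k = rcons s i', v s <= v (rcons s i'),
    v (rcons s (rev_ord i')) <= v (rcons s i') & v (rcons w j) <= v (rcons s i')].
  elim: k => [|k [s [i' [Wk vs vr vj]]]].
    by exists w, j; split => //; rewrite vw0 ltW.
  rewrite (_ : W k.+1 = nxt (W k))// Wk.
  have := hv s i'.
  have r1 := r0 (size s).+1; have r2 := r0 (size s).+2.
  set A := v s in vs *; set B := v (rcons s _) in vr *.
  set C := v (rcons s i') in vs vr vj *; set C1 := v _; set C2 := v _ => E.
  have CC : 2 * C <= C1 + C2.
    rewrite leNgt; apply/negP => lt.
    have : 0 < r (size s).+2 * (2 * C - C1 - C2) by apply: mulr_gt0 => //; lra.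
    have : 0 <= r (size s).+1 * (2 * C - A - B) by apply: mulr_ge0; [exact: ltW|lra].
    lra.
  exists (rcons s i'); rewrite /nxt -/C1 -/C2.
  have [le|le] := leP C1 C2.
    exists letter2; rewrite rev_letter2 -/C -/C1 -/C2; split => //; lra.
  exists letter1; rewrite rev_letter1 -/C -/C1 -/C2; split => //; lra.
have : v (rcons w j) <= 0.
  rewrite -(cvg_lim _ (limv W brW))//; apply: limr_ge.
    by apply/cvg_ex; exists 0; exact: limv.
  by apply: nearW => k /=; have [s [i' [-> _ _]]] := inv k.
by rewrite leNgt vj0.
Qed.

Lemma tree_harmonicN {R : realType} (r : nat -> R) (v : seq 'I_2 -> R) :
  tree_harmonic r v -> tree_harmonic r (fun w => - v w).
Proof. by move=> hv w i; have := hv w i; lra. Qed.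

Lemma tree_harmonicB {R : realType} (r : nat -> R) (v v' : seq 'I_2 -> R) :
  tree_harmonic r v -> tree_harmonic r v' -> tree_harmonic r (fun w => v w - v' w).
Proof. by move=> hv hv' w i; have := hv w i; have := hv' w i; lra. Qed.

(** Zeros propagate from a node to its children, since the one-sided bound applies to [v] and to
    [- v]. *)
Lemma tree_harmonic_eq0 {R : realType} (r : nat -> R) (v : seq 'I_2 -> R) :
  (forall k, 0 < r k) -> tree_harmonic r v -> v [::] = 0 ->
  (forall W, branch W -> v \o W @ \oo --> (0 : R)) ->
  forall w, v w = 0.
Proof.
move=> r0 hv v0 limv; elim/last_ind => // w i vw; apply/eqP; rewrite eq_le.
rewrite (tree_harmonic_le0 r v) //= -oppr_le0.
apply: (tree_harmonic_le0 r (fun w => - v w)) => //.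
- exact: tree_harmonicN.
- move=> W brW; rewrite -oppr0; apply: cvgN; exact: limv.
- by rewrite vw oppr0.
Qed.

Lemma tree_harmonic_uniq {R : realType} (r : nat -> R) (v v' : seq 'I_2 -> R) :
  (forall k, 0 < r k) -> tree_harmonic r v -> tree_harmonic r v' ->
  v [::] = v' [::] ->
  (forall W, branch W ->
     exists2 l : R, v \o W @ \oo --> l & v' \o W @ \oo --> l) ->
  v =1 v'.
Proof.
move=> r0 hv hv' v0 lim w; apply/eqP; rewrite -subr_eq0; apply/eqP.
apply: (tree_harmonic_eq0 r (fun w => v w - v' w)) => //.
- exact: tree_harmonicB.
- by rewrite v0 subrr.
- move=> W /lim[l vl v'l]; rewrite -(subrr l); exact: cvgB.
Qed.

(** For [w] longer than [om] this is the sign of the Haar function on the Cantor piece of [w], with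
    0 off the support; for the other words it is 0, the mean of that function over the piece. *)
Definition haar_sign {R : realType} (om w : seq 'I_2) : R :=
  if (size om < size w)%N && (take (size om) w == om) then
    if nth letter1 w (size om) == letter1 then 1 else -1
  else 0.

Lemma haar_sign_small {R : realType} (om w : seq 'I_2) :
  (size w <= size om)%N -> haar_sign om w = 0 :> R.
Proof. by rewrite /haar_sign ltnNge => ->. Qed.

Lemma haar_sign_rcons {R : realType} (om w : seq 'I_2) i :
  (size om < size w)%N -> haar_sign om (rcons w i) = haar_sign om w :> R.
Proof.
move=> lt; rewrite /haar_sign size_rcons lt ltnW//= nth_rcons lt.
by rewrite -cats1 takel_cat// ltnW.
Qed.

Lemma haar_sign_sibling {R : realType} (om w : seq 'I_2) i :
  (size w <= size om)%N ->
  haar_sign om (rcons w (rev_ord i)) = - haar_sign om (rcons w i) :> R.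
Proof.
rewrite leq_eqVlt => /orP[/eqP eq|lt]; last first.
  by rewrite !haar_sign_small ?size_rcons ?oppr0.
rewrite /haar_sign !size_rcons -eq ltnSn/= -!cats1 !take_size_cat//.
rewrite !nth_cat ltnn subnn /=; case: ifP => _; last by rewrite oppr0.
by have [->|->] := ord2P i; rewrite ?rev_letter1 ?rev_letter2 /= ?opprK.
Qed.

(** The index exceeds the word length by one: the top of a node of length m and the tops of its two
    children are the corners of a cell of level [n m.+1]. *)
Definition conductance {R : realType} (n : nat -> nat) (m : nat) : R := (5 / 3) ^+ n m.

Definition tree_flux {R : realType} (r : nat -> R) (v : seq 'I_2 -> R) (w : seq 'I_2) : R :=
  r (size w).+1 * (2 * v w - v (rcons w letter1) - v (rcons w letter2)).

(** Kirchhoff's equation, cleared of denominators, for values that agree on siblings, where [M m.+1]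
    is the ratio of a value in generation m+1 to that of its parent. It is applied with [M m.+1]
    equal to [m0 (y_ x m)]. *)
Definition ratio_rel {R : realType} (r M : nat -> R) : Prop :=
  forall m, M m.+1 * (r m.+1 + 2 * r m.+2 * (1 - M m.+2)) = r m.+1.

Definition tree_h0 {R : realType} (M : nat -> R) (w : seq 'I_2) : R :=
  \prod_(0 <= l < size w) M l.+1.

(** The deviation from the boundary value 1 shrinks by [M l.+1] per generation, as [tree_h0] does;
    its initial size is fixed by the equation at the children of the word that carries the Haar
    function. *)
Definition haar_radial {R : realType} (M : nat -> R) (j k : nat) : R :=
  1 - 3 * M j.+1 / (2 * M j.+1 + 1) * \prod_(j.+1 <= l < k) M l.+1.

Definition tree_haar {R : realType} (M : nat -> R) (om w : seq 'I_2) : R :=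
  Num.sqrt (2 ^+ size om) * haar_sign om w * haar_radial M (size om) (size w).

Lemma tree_h0_harmonic {R : realType} (r M : nat -> R) :
  ratio_rel r M -> tree_harmonic r (tree_h0 M).
Proof.
move=> rM w i; rewrite /tree_h0 !size_rcons !(@big_nat_recr _ _ _ (size w).+1)//=.
rewrite !(@big_nat_recr _ _ _ (size w))//=.
set P := \prod_(0 <= _ < _) _.
have := rM (size w); set m := size w => E.
transitivity (P * (M m.+1 * (r m.+1 + 2 * r m.+2 * (1 - M m.+2)) - r m.+1)); first ring.
by rewrite E subrr mulr0.
Qed.

(** Inside one half of the Haar cell siblings have equal values, so the current entering a node from
    its parent splits into two equal currents. *)
Lemma haar_radial_step {R : realType} (r M : nat -> R) (j m : nat) :
  ratio_rel r M -> (j < m)%N ->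
  r m.+1 * (haar_radial M j m.+1 - haar_radial M j m) =
  2 * r m.+2 * (haar_radial M j m.+2 - haar_radial M j m.+1).
Proof.
move=> rM jm; rewrite /haar_radial !(@big_nat_recr _ _ _ m.+1) ?(leq_trans jm)//=.
rewrite !(@big_nat_recr _ _ _ m)//=.
set P := \prod_(_ <= _ < _) _; set B := 3 * _ / _.
have E := rM m; apply/eqP; rewrite -subr_eq0; apply/eqP.
transitivity (- (B * P * (M m.+1 * (r m.+1 + 2 * r m.+2 * (1 - M m.+2)) - r m.+1))); first ring.
by rewrite E subrr mulr0 oppr0.
Qed.

(** The source of the fraction in [dn_multiplier]. *)
Lemma haar_radial_start {R : realType} (M : nat -> R) (j : nat) :
  0 <= M j.+1 -> haar_radial M j j.+1 = (1 - M j.+1) / (2 * M j.+1 + 1).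
Proof.
move=> M0; rewrite /haar_radial big_geq// mulr1.
have : 2 * M j.+1 + 1 != 0 by apply/lt0r_neq0; lra.
by move=> ?; field.
Qed.

(* Both sides are the current leaving the top of a child of the node that
   carries the Haar function: the antisymmetric value sees its parent at 0 and
   its sibling at the opposite value. *)
Lemma haar_radial_top {R : realType} (r M : nat -> R) (j : nat) :
  ratio_rel r M -> 0 <= M j.+1 ->
  3 * r j.+1 * haar_radial M j j.+1 =
  2 * r j.+2 * (haar_radial M j j.+2 - haar_radial M j j.+1).
Proof.
move=> rM M0; rewrite /haar_radial big_nat1 big_geq//.
have nz : 2 * M j.+1 + 1 != 0 by apply/lt0r_neq0; lra.
have E := rM j; apply/eqP; rewrite -subr_eq0; apply/eqP.
transitivity (3 / (2 * M j.+1 + 1) * (r j.+1 - M j.+1 * (r j.+1 + 2 * r j.+2 * (1 - M j.+2)))).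
  by field.
by rewrite E subrr mulr0.
Qed.

Lemma tree_haar_harmonic {R : realType} (r M : nat -> R) (om : seq 'I_2) :
  ratio_rel r M -> (forall k, 0 <= M k) -> tree_harmonic r (tree_haar M om).
Proof.
move=> rM M0 w i; rewrite /tree_haar !size_rcons.
set c := Num.sqrt _; set j := size om; set m := size w.
(* Three positions of [w]: longer than [om], where the solution is locally symmetric; as long as
   [om], where [haar_radial_top] applies; shorter, where the node has value 0 and its children have
   opposite values. *)
have [jm|mj] := ltnP j m.
  have jm' i' : (j < size (rcons w i'))%N by rewrite size_rcons ltnW.
  rewrite !(haar_sign_rcons om (rcons w i)) ?jm'// !(haar_sign_rcons om w)//.
  have := haar_radial_step r M j m rM jm; set s := haar_sign om w => E.
  transitivity (c * s * (r m.+1 * (haar_radial M j m.+1 - haar_radial M j m) -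
    2 * r m.+2 * (haar_radial M j m.+2 - haar_radial M j m.+1))); first ring.
  by rewrite E subrr mulr0.
rewrite (haar_sign_sibling om w i mj) (haar_sign_small om w mj).
move: mj; rewrite leq_eqVlt => /orP[/eqP mj|mj].
  have jm' : (j < size (rcons w i))%N by rewrite size_rcons -/m mj.
  rewrite !(haar_sign_rcons om (rcons w i))// mj.
  set s := haar_sign _ _.
  have := haar_radial_top r M j rM (M0 _) => E.
  transitivity (c * s * (3 * r j.+1 * haar_radial M j j.+1 -
    2 * r j.+2 * (haar_radial M j j.+2 - haar_radial M j j.+1))); first ring.
  by rewrite E subrr mulr0.
have := haar_sign_sibling (R := R) om (rcons w i) letter1.
rewrite rev_letter1 size_rcons => -> //.
rewrite (haar_sign_small om (rcons w i)) ?size_rcons//; ring.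
Qed.

(** Conservation of current: the nodes of each generation carry equal shares of the current that
    leaves the root. *)
Lemma tree_h0_flux {R : realType} (r M : nat -> R) (w : seq 'I_2) :
  ratio_rel r M ->
  2 ^+ size w * tree_flux r (tree_h0 M) w = 2 * r 1%N * (1 - M 1%N).
Proof.
move=> rM; rewrite /tree_flux /tree_h0 !size_rcons; elim: (size w) => [|m IH].
  rewrite big_nat1 big_geq//; ring.
rewrite -IH !(@big_nat_recr _ _ _ m.+1)//= !(@big_nat_recr _ _ _ m)//= exprS.
have E := rM m; set P := \prod_(0 <= _ < _) _.
apply/eqP; rewrite -subr_eq0; apply/eqP.
transitivity (2 * 2 ^+ m * P * (M m.+1 * (r m.+1 + 2 * r m.+2 * (1 - M m.+2)) - r m.+1)).
  ring.
by rewrite E subrr mulr0.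
Qed.

Lemma tree_haar_flux_small {R : realType} (r M : nat -> R) (om w : seq 'I_2) :
  (size w <= size om)%N -> tree_flux r (tree_haar M om) w = 0.
Proof.
move=> wo; rewrite /tree_flux /tree_haar.
have := haar_sign_sibling (R := R) om w letter1 wo; rewrite rev_letter1 => ->.
rewrite !size_rcons haar_sign_small//; ring.
Qed.

(** This produces the multiplier: again by conservation, the flux can be evaluated at the children
    of [om]. *)
Lemma tree_haar_flux {R : realType} (r M : nat -> R) (om w : seq 'I_2) :
  ratio_rel r M -> (forall k, 0 <= M k) -> (size om < size w)%N ->
  2 ^+ size w * tree_flux r (tree_haar M om) w =
  - (6 * 2 ^+ size om * r (size om).+1 *
     ((1 - M (size om).+1) / (2 * M (size om).+1 + 1))) *
  (Num.sqrt (2 ^+ size om) * haar_sign om w).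
Proof.
move=> rM M0 lt; rewrite /tree_flux /tree_haar !haar_sign_rcons// !size_rcons.
set c := Num.sqrt _; set s := haar_sign _ _; set j := size om in lt *.
rewrite -haar_radial_start//.
(* The left side does not depend on the generation below [om]. The base case [haar_radial_top]
   supplies a factor 3, and the two edges going down from [w] supply the factor 2, which together
   give 6. *)
suff E : 2 ^+ size w * (r (size w).+1 * (haar_radial M j (size w).+1 - haar_radial M j (size w)))
   = 2 ^+ j * (3 * r j.+1 * haar_radial M j j.+1).
  transitivity (- (2 * c * s * (2 ^+ size w * (r (size w).+1 *
    (haar_radial M j (size w).+1 - haar_radial M j (size w)))))); first ring.
  by rewrite E; ring.
rewrite -(subnKC lt); elim: (size w - j.+1)%N => [|k IH].
  rewrite addn0 haar_radial_top// exprS; ring.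
rewrite addnS -IH exprS (haar_radial_step r M j (j.+1 + k))//.
  by rewrite -!mulrA mulrCA.
by rewrite addSn ltnS leq_addr.
Qed.

(** * The function m_0 and binary expansions *)

(** For [n := expo x] the value at [m.+1] is [m0 (y_ x m)], by [m0_y]; moving the index replaces
    rescaling the number. *)
Definition m0_from {R : realType} (n : nat -> nat) (j : nat) : R :=
  limn (fun k => m0_rec n k j).

Section BackwardRecursion.
Context {R : realType} (n : nat -> nat) (n_incr : forall k, (n k < n k.+1)%N).

Lemma conductance_ratio_ge j : 5 / 3 <= (5 / 3 : R) ^+ (n j.+1 - n j).
Proof.
rewrite -[leLHS]expr1 ler_eXn2l; last by lra.
by rewrite subn_gt0.
Qed.

Lemma m0_step_homo (A t t' : R) : 5 / 3 <= A -> t <= t' -> t' <= 3 / 10 ->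
  (1 + 2 * A * (1 - t))^-1 <= (1 + 2 * A * (1 - t'))^-1.
Proof.
move=> A5 tt' t'3.
have : 0 <= A * (1 - t') by apply: mulr_ge0; lra.
have : 0 <= A * (t' - t) by apply: mulr_ge0; lra.
by move=> *; rewrite lef_pV2 ?posrE; lra.
Qed.

(** 3/10 is the fixed point below 1 of the recursion with the smallest possible ratio 5/3: 1 + 2 *
    5/3 * 7/10 = 10/3. *)
Lemma m0_rec_bounds d j : 0 <= (m0_rec n d j : R) <= 3 / 10.
Proof.
elim: d j => [|d IH] j /=; first lra.
have A5 := conductance_ratio_ge j; have /andP[t0 t3] := IH j.+1.
have := m0_step_homo _ _ _ A5 t3 (lexx _).
have : 0 <= ((5 / 3) ^+ (n j.+1 - n j) - 5 / 3 : R) * (1 - 3 / 10) by apply: mulr_ge0; lra.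
set A := _ ^+ _ in A5 * => AA.
have : (1 + 2 * A * (1 - 3 / 10))^-1 <= 3 / 10.
  rewrite -[leRHS]invrK lef_pV2 ?posrE; lra.
have : 0 <= A * (1 - m0_rec n d j.+1) by apply: mulr_ge0; lra.
by move=> ? ? ?; rewrite invr_ge0; apply/andP; split; lra.
Qed.

(** One more step replaces the initial value 0 by a nonnegative one, and every step is nondecreasing
    in its argument. *)
Lemma m0_rec_homo d j : (m0_rec n d j : R) <= m0_rec n d.+1 j.
Proof.
elim: d j => [|d IH] j; first by have /andP[] := m0_rec_bounds 1 j.
apply: m0_step_homo; [exact: conductance_ratio_ge|exact: IH|].
by have /andP[] := m0_rec_bounds d.+1 j.+1.
Qed.

Lemma m0_rec_cvg j : (m0_rec n k j : R) @[k --> \oo] --> (m0_from n j : R).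
Proof.
apply: nondecreasing_is_cvgn.
  by apply/nondecreasing_seqP => k; exact: m0_rec_homo.
by exists (3 / 10) => _ [k _ <-]; have /andP[] := m0_rec_bounds k j.
Qed.

Lemma m0_from_bounds j : 0 <= (m0_from n j : R) <= 3 / 10.
Proof.
have c : cvgn (fun k => m0_rec n k j : R) by apply/cvg_ex; eexists; exact: m0_rec_cvg.
apply/andP; split; [apply: limr_ge|apply: limr_le] => //;
  by apply: nearW => k; have /andP[] := m0_rec_bounds k j.
Qed.

Lemma m0_fromE j :
  (m0_from n j : R) = (1 + 2 * (5 / 3) ^+ (n j.+1 - n j) * (1 - m0_from n j.+1))^-1.
Proof.
have A5 := conductance_ratio_ge j; have /andP[t0 t3] := m0_from_bounds j.+1.
set A := _ ^+ _ in A5 *.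
have : 0 <= A * (1 - m0_from n j.+1) by apply: mulr_ge0; lra.
move=> A0; apply: (@cvg_unique _ _ (m0_rec n k.+1 j @[k --> \oo])) => //.
  by have := m0_rec_cvg j; rewrite -cvg_shiftS.
rewrite /= -/A; apply: cvgV; first by apply/lt0r_neq0; lra.
apply: cvgD; first exact: cvg_cst.
apply: cvgM; first exact: cvg_cst.
by apply: cvgB; [exact: cvg_cst|exact: m0_rec_cvg].
Qed.

Lemma m0_from_ratio : ratio_rel (conductance n) (m0_from n : nat -> R).
Proof.
move=> m; rewrite /conductance (m0_fromE m.+1).
have -> : (5 / 3) ^+ n m.+2 = (5 / 3) ^+ (n m.+2 - n m.+1) * (5 / 3) ^+ n m.+1 :> R.
  by rewrite -exprD subnK// ltnW.
have A5 := conductance_ratio_ge m.+1; have /andP[t0 t3] := m0_from_bounds m.+2.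
set A := _ ^+ (_ - _) in A5 *; set M := m0_from n _ in t0 t3 *.
have : 0 <= A * (1 - M) by apply: mulr_ge0; lra.
move=> A0; have : 1 + 2 * A * (1 - M) != 0 by apply/lt0r_neq0; lra.
by move=> nz; field.
Qed.

End BackwardRecursion.

(** The recursion sees the exponents only through their gaps from index 1 on, and these gaps are the
    same for a number and its rescaled remainders. *)
Lemma m0_rec_shift {R : realType} (n n' : nat -> nat) m d j :
  (forall k, (n' k.+2 - n' k.+1 = n (m + k).+2 - n (m + k).+1)%N) ->
  (m0_rec n' d j.+1 : R) = m0_rec n d (m + j).+1.
Proof. by move=> nn'; elim: d j => //= d IH j; rewrite nn' IH addnS. Qed.

Lemma m0_shift {R : realType} (x : R) (n : nat -> nat) m :
  (forall k, (n k < n k.+1)%N) ->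
  (forall k, (expo x k.+2 - expo x k.+1 = n (m + k).+2 - n (m + k).+1)%N) ->
  m0 x = m0_from n m.+1.
Proof.
move=> n_incr nn'; apply: cvg_lim => //.
(* Going from t_k to t_1 takes k - 1 steps, whence [k.-1] in [m0]; shifting k by one removes the
   predecessor. *)
rewrite -(cvg_shiftS (fun k => m0_rec (expo x) k.-1 1 : R)) /=.
under eq_fun do rewrite (m0_rec_shift n (expo x) m _ 0)//.
by rewrite addn0; exact: m0_rec_cvg.
Qed.

(** * Binary exponents of a number and of its remainders *)

Section BinaryExpansion.
Context {R : realType}.
Implicit Types (x : R) (n : nat -> nat).

(** For [n := expo x] this is the depth of the tops of the cells of generation m. *)
Definition binary_partial n (m : nat) : R := \sum_(0 <= k < m) 2 ^- n k.+1.

Lemma binary_partialS n m : binary_partial n m.+1 = binary_partial n m + 2 ^- n m.+1.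
Proof. by rewrite /binary_partial big_nat_recr. Qed.

Lemma exp2V_gt0 k : 0 < 2 ^- k :> R.
Proof. by rewrite invr_gt0 exprn_gt0. Qed.

Lemma exp2VS k : 2 ^- k = 2 * 2 ^- k.+1 :> R.
Proof. by rewrite exprS invfM mulVKf// pnatr_eq0. Qed.

Lemma exp2V_le k l : ((2 ^- k : R) <= 2 ^- l) = (l <= k)%N.
Proof. by rewrite lef_pV2 ?posrE ?exprn_gt0// ler_eXn2l// ltr1n. Qed.

Lemma exp2V_lt k l : ((2 ^- k : R) < 2 ^- l) = (l < k)%N.
Proof. by rewrite ltNge exp2V_le ltnNge. Qed.

Lemma exp2V_cvg0 n : (forall k, (n k < n k.+1)%N) -> 2 ^- n k @[k --> \oo] --> (0 : R).
Proof.
move=> n_incr; have kn k : (k <= n k)%N by elim: k => // k /leq_ltn_trans; exact.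
apply: (@squeeze_cvgr _ _ _ _ (cst 0) (fun k => 2^-1 ^+ k)).
- by apply: nearW => k; rewrite ltW ?exp2V_gt0//= exprVn exp2V_le.
- exact: cvg_cst.
- by apply: cvg_expr; rewrite ger0_norm; lra.
Qed.

Lemma binary_partial_le x n m : is_binary_exponents x n -> binary_partial n m < x.
Proof.
move=> [n0 n_incr nx].
have : binary_partial n m.+1 <= x.
  rewrite -(cvg_lim _ nx)//; apply: nondecreasing_cvgn_le.
    apply/nondecreasing_seqP => k; rewrite -!/(binary_partial n _) binary_partialS.
    by rewrite lerDl ltW ?exp2V_gt0.
  by apply/cvg_ex; exists x.
by apply: lt_le_trans; rewrite binary_partialS ltrDl exp2V_gt0.
Qed.

Lemma binary_partial_ge x n : is_binary_exponents x n -> x <= 2 * 2 ^- n 1%N.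
Proof.
move=> [n0 n_incr nx]; rewrite -(cvg_lim _ nx)//; apply: limr_le.
  by apply/cvg_ex; exists x.
(* The subtracted term makes the bound inductive, because consecutive exponents differ by at least
   1. *)
suff H k : binary_partial n k.+1 <= 2 * 2 ^- n 1%N - 2 ^- n k.+1.
  apply: nearW => N; rewrite (_ : series _ N = binary_partial n N)//; case: N => [|k].
    by rewrite /binary_partial big_geq// mulr_ge0// ltW// exp2V_gt0.
  by apply: le_trans (H k) _; rewrite lerBlDr lerDl ltW ?exp2V_gt0.
elim: k => [|k IH].
  by rewrite /binary_partial big_nat1 mulr_natl mulr2n addrK.
rewrite binary_partialS.
have : 2 ^- n k.+2 <= 2 ^- (n k.+1).+1 :> R by rewrite exp2V_le.
have := exp2VS (n k.+1); lra.
Qed.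

(** The exponents of a remainder are a tail of [n], with the entry at 0 reset to 0 to respect the
    convention n_0 = 0. *)
Lemma binary_remainder x n m : is_binary_exponents x n ->
  is_binary_exponents (x - binary_partial n m) (fun k => if k is 0 then 0 else n (m + k))%N.
Proof.
move=> [n0 n_incr nx]; split => //.
  case=> [|k]; last by rewrite !addnS.
  by rewrite addn1 (leq_ltn_trans (leq0n _) (n_incr m)).
have E : series (fun k => 2 ^- n (m + k.+1) : R) =
    (fun N => binary_partial n (N + m) - binary_partial n m).
  apply/funext; elim=> [|N IH]; first by rewrite /series/= big_geq// add0n subrr.
  by rewrite seriesSr IH addSn binary_partialS addrAC -addnS [(N + m.+1)%N]addnC addSnnS.
rewrite E; apply: cvgB; last exact: cvg_cst.
by rewrite (cvg_shiftn m (series (fun k => 2 ^- n k.+1 : R))).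
Qed.

Lemma binary_remainder_bounds x n m : is_binary_exponents x n ->
  2 ^- n m.+1 < x - binary_partial n m <= 2 * 2 ^- n m.+1.
Proof.
move=> xn; have := binary_partial_ge _ _ (binary_remainder x n m xn).
have := binary_partial_le _ _ m.+1 xn; rewrite binary_partialS addn1; lra.
Qed.

(** The bounds on a number determine its first exponent; applied to the successive remainders, they
    determine the others. *)
Lemma binary_exponents_uniq x n n' :
  is_binary_exponents x n -> is_binary_exponents x n' -> n = n'.
Proof.
move=> xn xn'.
have H (y : R) (p p' : nat -> nat) : is_binary_exponents y p -> is_binary_exponents y p' ->
    (p' 1 <= p 1)%N.
  move=> yp yp'; have {}yp' := binary_partial_ge _ _ yp'.
  have := binary_remainder_bounds _ _ 0 yp; rewrite /binary_partial big_geq// => /andP[lt _].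
  have {}lt : 2 ^- p 1%N < 2 * 2 ^- p' 1%N :> R by lra.
  rewrite -ltnS -(exp2V_lt (p 1%N).+1).
  by have := exp2VS (p 1%N); lra.
suff E k : forall i, (i <= k)%N -> n i = n' i by apply/funext => k; exact: (E k).
elim: k => [|k IH] i; first by rewrite leqn0 => /eqP->; case: xn => ->; case: xn' => ->.
rewrite leq_eqVlt => /orP[/eqP->{i}|]; last exact: IH.
have pE : binary_partial n k = binary_partial n' k.
  by apply: eq_big_nat => l /andP[_ lk]; rewrite IH.
have rn := binary_remainder _ _ k xn; have := binary_remainder _ _ k xn'.
rewrite -pE => rn'.
by apply/eqP; rewrite eqn_leq -addn1; apply/andP; split; [exact: H rn' rn|exact: H rn rn'].
Qed.

Lemma leading_exponent x : 0 < x <= 1 ->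
  exists e, (0 < e)%N /\ 2 ^- e < x <= 2 * 2 ^- e.
Proof.
move=> /andP[x0 x1].
have [e ex] : exists e, 2 ^- e < x.
  have [N _ /(_ N (leqnn N))] := near_infty_natSinv_expn_lt (PosNum x0).
  by rewrite /= div1r => ?; exists N.
have exP : exists e, 2 ^- e < x by exists e.
case: (ex_minnP exP) => -[|k] kx kmin.
  by move: kx; rewrite expr0 invr1 ltNge x1.
exists k.+1; split => //; rewrite kx -exp2VS leNgt.
by apply/negP => /kmin; rewrite ltnn.
Qed.

(** Greedy expansion: the strict lower bound on the leading exponent keeps every remainder [X k]
    positive, so the expansion never stops. *)
Lemma binary_exponents_exist x : 0 < x <= 1 -> exists n, is_binary_exponents x n.
Proof.
move=> x01.
have /choice[e eP] (y : R) : exists e, 0 < y <= 1 -> (0 < e)%N /\ 2 ^- e < y <= 2 * 2 ^- e.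
  have [/leading_exponent[k]|] := boolP (0 < y <= 1); first by exists k.
  by exists 0%N.
pose X k := iter k (fun y => y - 2 ^- e y) x.
have XS k : X k.+1 = X k - 2 ^- e (X k) by [].
have X01 k : 0 < X k <= 1.
  elim: k => // k /[dup] /andP[X0 X1] /eP[_ /andP[lo hi]]; rewrite XS.
  by have := exp2V_gt0 (e (X k)); lra.
pose n k := if k is k'.+1 then e (X k') else 0%N.
have n_incr k : (n k < n k.+1)%N.
  have [e0 /andP[lo hi]] := eP _ (X01 k); case: k e0 lo hi => [|k]// e0 lo hi.
  have [_ /andP[_ hi']] := eP _ (X01 k).
  by rewrite /n -exp2V_lt (lt_le_trans lo)//; have := XS k; lra.
exists n; split => //.
have E : series (fun k => 2 ^- n k.+1) = (fun k => x - X k).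
  apply/funext; elim=> [|k IH]; first by rewrite /series/= big_geq// subrr.
  by rewrite seriesSr IH XS /=; ring.
rewrite E -[X in _ --> X]subr0; apply: cvgB; first exact: cvg_cst.
apply: (@squeeze_cvgr _ _ _ _ (cst 0) (fun k => 2 ^- n k)).
- apply: nearW => k /=; have /andP[X0 X1] := X01 k; rewrite ltW//=.
  case: k X0 X1 => [|k] X0 X1 /=; first by rewrite expr0 invr1.
  by have [_ /andP[_ hi]] := eP _ (X01 k); lra.
- exact: cvg_cst.
- exact: exp2V_cvg0.
Qed.

Lemma expoP x : 0 < x <= 1 -> is_binary_exponents x (expo x).
Proof. by move=> x01; have [n ?] := binary_exponents_exist x x01; apply: getPex; exists n. Qed.

Lemma expoE x n : 0 < x <= 1 -> is_binary_exponents x n -> expo x = n.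
Proof. by move=> x01; exact/binary_exponents_uniq/expoP. Qed.

Section Nondyadic.
Context (x : R) (x01 : 0 < x < 1) (xnd : nondyadic x).
Let n := expo x.
Let xn : is_binary_exponents x n.
Proof. by case/andP: x01 => x0 x1; apply: expoP; rewrite x0 ltW. Qed.

Lemma expo_incr k : (expo x k < expo x k.+1)%N.
Proof. by case: xn. Qed.

Lemma expo_le m k : (expo x m <= expo x (m + k))%N.
Proof. by elim: k => [|k IH]; rewrite ?addn0// addnS (leq_trans IH)// ltnW// expo_incr. Qed.

Lemma binary_partial_dyadic m : exists K : nat, binary_partial n m = K%:R / 2 ^+ n m :> R.
Proof.
elim: m => [|m [K E]].
  by exists 0%N; rewrite mul0r /binary_partial big_geq.
exists (K * 2 ^ (n m.+1 - n m) + 1)%N.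
rewrite binary_partialS E natrD natrM natrX mulrDl mul1r; congr (_ + _).
have -> : 2 ^+ n m.+1 = 2 ^+ (n m.+1 - n m) * 2 ^+ n m :> R.
  by rewrite -exprD subnK// ltnW// expo_incr.
have nz k : 2 ^+ k != 0 :> R by rewrite expf_neq0// pnatr_eq0.
by field; rewrite !nz.
Qed.

(** Geometrically, the line crosses a cell of generation m strictly above its bottom edge and
    strictly below its top subcell of height [2 ^- n m.+1]. *)
Lemma remainder_bounds m :
  2 ^- n m.+1 < x - binary_partial n m /\ x - binary_partial n m < 2 ^- n m.
Proof.
have /andP[lo hi] := binary_remainder_bounds _ _ m xn; split => //.
have le : x - binary_partial n m <= 2 ^- n m.
  by apply: le_trans hi _; rewrite [leRHS]exp2VS ler_pM2l// exp2V_le expo_incr.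
(* Equality would make [x] dyadic, with numerator K + 1 over [2 ^+ n m]. *)
rewrite lt_neqAle le andbT; apply/negP => /eqP E.
have [K KE] := binary_partial_dyadic m.
have := xnd K.+1 (n m); rewrite -addn1 natrD mulrDl -KE mul1r -E addrC subrK eqxx //.
Qed.

Lemma iter_drop_leading m : iter m drop_leading x = x - binary_partial n m.
Proof.
elim: m => [|m IH]; first by rewrite /binary_partial big_geq// subr0.
rewrite iterS IH /drop_leading (expoE _ _ _ (binary_remainder _ _ m xn)).
  by rewrite addn1 binary_partialS opprD addrA.
have [lo hi] := remainder_bounds m; have := exp2V_gt0 (n m.+1).
have : 2 ^- n m <= 2 ^- 0%N :> R by rewrite exp2V_le.
rewrite expr0 invr1; lra.
Qed.

(** Multiplication by [2 ^+ n m] lowers every exponent of the m-th remainder by [n m]; uniqueness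
    identifies the result. *)
Lemma expo_y m k : expo (y_ x m) k = (expo x (m + k) - expo x m)%N.
Proof.
have ne : forall m' k', (n m' <= n (m' + k'))%N by exact: expo_le.
suff: is_binary_exponents (y_ x m) (fun k => n (m + k) - n m)%N.
  move=> yn; rewrite (expoE _ _ _ yn)//.
  have [lo hi] := remainder_bounds m; have := exp2V_gt0 (n m.+1) => p0.
  rewrite /y_ iter_drop_leading -/n; apply/andP; split.
    by apply: mulr_gt0; [exact: exprn_gt0|lra].
  by rewrite -ler_pdivlMl ?exprn_gt0// mulr1 ltW.
split; first by rewrite addn0 subnn.
  by move=> j; rewrite ltn_sub2r// ?addnS ?expo_incr// (leq_ltn_trans (ne m j))// expo_incr.
have [_ _ rn] := binary_remainder _ _ m xn.
rewrite /y_ iter_drop_leading -/n.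
rewrite (_ : series _ = (fun N => 2 ^+ n m * series (fun k => 2 ^- n (m + k.+1)%N) N)).
  by apply: cvgM => //; exact: cvg_cst.
apply/funext => N; rewrite /series/= mulr_sumr; apply: eq_bigr => j _.
have -> : 2 ^+ n (m + j.+1) = 2 ^+ (n (m + j.+1) - n m) * 2 ^+ n m :> R.
  by rewrite -exprD subnK.
by rewrite invfM mulrCA mulfV ?mulr1// expf_neq0// pnatr_eq0.
Qed.

Lemma m0_y m : m0 (y_ x m) = m0_from (expo x) m.+1.
Proof.
apply: m0_shift; first exact: expo_incr.
have le k : (expo x m <= expo x (m + k))%N by exact: expo_le.
by move=> k; rewrite !expo_y subnBA ?subnK// !addnS.
Qed.

End Nondyadic.

End BinaryExpansion.

(** * Cells and vertices of the gasket *)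

Section Barycentric.
Context {R : realType}.
Implicit Types (p : plane R) (i j a b : 'I_3) (w v : seq 'I_3).

(** Barycentric coordinates with respect to the corners; in them [F j] is the average with the j-th
    unit vector. *)
Definition bary i p : R :=
  match val i with
  | 0 => p.2
  | 1 => (1 - p.2 - Num.sqrt 3 * p.1) / 2
  | _ => (1 - p.2 + Num.sqrt 3 * p.1) / 2
  end.

Lemma sqrt3V : Num.sqrt 3 * (Num.sqrt 3)^-1 = 1 :> R.
Proof. by rewrite mulfV// gt_eqF// sqrtr_gt0 ltr0n. Qed.

Lemma bary_q i j : bary i (q j) = (i == j)%:R.
Proof.
have s3 := sqrt3V.
by case: i j => -[|[|[|//]]] ? [[|[|[|//]]] ?]; rewrite /bary/q -val_eqE/= ?mulrN ?s3; lra.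
Qed.

Lemma bary_F i j p : bary i (F j p) = (bary i p + (i == j)%:R) / 2.
Proof. by rewrite -bary_q /bary/F; case: (val i) => [|[|?]] /=; lra. Qed.

Lemma bary_inj p p' : (forall i, bary i p = bary i p') -> p = p'.
Proof.
move=> pp'; have := pp' ord0; have := pp' (lift ord0 ord0); have := pp' ord_max.
rewrite /bary/=; case: p p' {pp'} => [x y] [x' y'] /= h1 h2 h0.
have s3 : 0 < Num.sqrt 3 :> R by rewrite sqrtr_gt0 ltr0n.
have : Num.sqrt 3 * x = Num.sqrt 3 * x' by lra.
by move=> /(mulfI (lt0r_neq0 s3)) ->; rewrite h0.
Qed.

Lemma ord3_mem j a b c : uniq [:: j; a; b] -> c \in [:: j; a; b].
Proof.
rewrite /= !inE -!val_eqE /=.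
by have := ltn_ord j; have := ltn_ord a; have := ltn_ord b; have := ltn_ord c; lia.
Qed.

Lemma ord3_sum (f : 'I_3 -> R) j a b : uniq [:: j; a; b] -> \sum_c f c = f j + f a + f b.
Proof.
move=> u; have -> : \sum_c f c = \sum_(c <- [:: j; a; b]) f c.
  apply: perm_big; apply: uniq_perm => //; first exact: index_enum_uniq.
  by move=> c; rewrite ord3_mem// mem_index_enum.
by rewrite !big_cons big_nil addr0 addrA.
Qed.

Lemma bary_sum p : \sum_i bary i p = 1.
Proof.
rewrite !big_ord_recl big_ord0 /bary/=; lra.
Qed.

Lemma bary_continuous i : continuous (bary i).
Proof.
move=> p; have c1 : (fun p' : plane R => p'.1) @ p --> p.1 by exact: cvg_fst.
have c2 : (fun p' : plane R => p'.2) @ p --> p.2 by exact: cvg_snd.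
rewrite /bary /continuous_at; case: (val i) => [|[|?]] //.
- apply: cvgM; last exact: cvg_cst.
  apply: cvgB; last by apply: cvgM => //; exact: cvg_cst.
  by apply: cvgB => //; exact: cvg_cst.
- apply: cvgM; last exact: cvg_cst.
  apply: cvgD; last by apply: cvgM => //; exact: cvg_cst.
  by apply: cvgB => //; exact: cvg_cst.
Qed.

Lemma F_continuous i : continuous (F i : plane R -> plane R).
Proof.
move=> p; have c1 : (fun p' : plane R => p'.1) @ p --> p.1 by exact: cvg_fst.
have c2 : (fun p' : plane R => p'.2) @ p --> p.2 by exact: cvg_snd.
by apply: (@cvg_pair _ _ _ _ (nbhs ((p.1 + (q i).1) / 2)) (nbhs ((p.2 + (q i).2) / 2))); do 2?[apply: cvgM|apply: cvgD] => //; exact: cvg_cst.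
Qed.

Lemma Fword_continuous w : continuous (Fword w : plane R -> plane R).
Proof.
elim: w => [|i w IH] p /=; first exact: cvg_id.
by apply: continuous_comp; [exact: IH|exact: F_continuous].
Qed.

Lemma Fword_cat w v p : Fword (w ++ v) p = Fword w (Fword v p).
Proof. by elim: w => //= i w ->. Qed.

Lemma Fword_rcons w i p : Fword (rcons w i) p = Fword w (F i p).
Proof. by rewrite -cats1 Fword_cat. Qed.

Lemma F_q i : F i (q i) = q i :> plane R.
Proof. by apply: bary_inj => j; rewrite bary_F bary_q; lra. Qed.

Lemma Fword_nseq_q k i : Fword (nseq k i) (q i) = q i :> plane R.
Proof. by elim: k => //= k ->; exact: F_q. Qed.

Lemma F_qC i j : F i (q j) = F j (q i) :> plane R.
Proof. by apply: bary_inj => l; rewrite !bary_F !bary_q addrC. Qed.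

Lemma F_inj i : injective (F i : plane R -> plane R).
Proof.
move=> p p' pp'; apply: bary_inj => j.
by have := congr1 (bary j) pp'; rewrite !bary_F; lra.
Qed.

Lemma Fword_inj w : injective (Fword w : plane R -> plane R).
Proof. by elim: w => //= i w IH p p' /F_inj /IH. Qed.

Lemma q_inj : injective (q : 'I_3 -> plane R).
Proof.
move=> i j /(congr1 (bary i)); rewrite !bary_q eqxx.
by case: eqP => // _ /eqP; rewrite oner_eq0.
Qed.

Definition in_triangle p := forall i, 0 <= bary i p.

Lemma triangle_q i : in_triangle (q i).
Proof. by move=> j; rewrite bary_q. Qed.

Lemma triangle_F i p : in_triangle p -> in_triangle (F i p).
Proof. by move=> tp j; rewrite bary_F; have := tp j; have := ler0n R (j == i); lra. Qed.

Lemma triangle_Fword w p : in_triangle p -> in_triangle (Fword w p).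
Proof. by move=> tp; elim: w => //= i w IH; exact: triangle_F. Qed.

Lemma bary_le1 i p : in_triangle p -> bary i p <= 1.
Proof.
move=> tp; rewrite -(bary_sum p) (bigD1 i)//= lerDl sumr_ge0//.
Qed.

Lemma bary_eq1 i p : in_triangle p -> 1 <= bary i p -> p = q i.
Proof.
move=> tp pi; apply: bary_inj => j; rewrite bary_q.
have s := bary_sum p; have := bary_le1 i p tp => pi1.
have [->|ji] := eqVneq j i; first by rewrite mulr1n; lra.
move: s; rewrite (bigD1 i)//= (bigD1 j)//=.
have : 0 <= \sum_(k < 3 | (k != i) && (k != j)) bary k p by apply: sumr_ge0.
have := tp j; rewrite mulr0n; lra.
Qed.

(** A point of the j-th cell has j-th coordinate at least 1/2, while in the i-th cell this
    coordinate is half that of [p]. *)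
Lemma F_overlap i j p p' : i != j -> in_triangle p -> in_triangle p' ->
  F i p = F j p' -> p = q j.
Proof.
move=> ij tp tp' E; apply: bary_eq1 => //.
have := congr1 (bary i) E; have := congr1 (bary j) E.
rewrite !bary_F !eqxx (negbTE ij) eq_sym (negbTE ij).
have := bary_le1 i p' tp'; have := tp' j; have := tp i; have := tp j.
have := bary_le1 j p tp => /=; rewrite ?mulr0n ?mulr1n; lra.
Qed.

Lemma F_eq_q i j p : in_triangle p -> F i p = q j -> i = j /\ p = q j.
Proof.
move=> tp E; have := congr1 (bary j) E; rewrite bary_F bary_q eqxx.
move: (bary_le1 j p tp) => {E}; have [->|ji] /= := eqVneq j i; last by rewrite mulr0n => ? ?; exfalso; lra.
by rewrite mulr1n => _ E; split => //; apply: bary_eq1 => //; lra.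
Qed.

Lemma Fword_eq_q w j p : in_triangle p -> Fword w p = q j ->
  w = nseq (size w) j /\ p = q j.
Proof.
move=> tp; elim: w => //= i w IH /(F_eq_q _ _ _ (triangle_Fword _ _ tp))[-> /IH[wE ->]].
by rewrite -wE.
Qed.

(** At each finer level a junction point is a vertex of exactly two cells. A word that departs from
    [v] earlier would, by [F_overlap], make the junction a corner of a cell one step up, which
    [i != j] forbids. *)
Lemma Fword_junction v i j k w a : i != j -> size w = (size v + 1 + k)%N ->
  Fword w (q a) = Fword v (F i (q j)) :> plane R ->
  (w = v ++ i :: nseq k j /\ a = j) \/ (w = v ++ j :: nseq k i /\ a = i).
Proof.
move=> ij; elim: v w => [|d v IH] [|c w] //=; rewrite ?add0n ?add1n => -[sw] E.
- have tw : in_triangle (Fword w (q a)) by exact/triangle_Fword/triangle_q.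
  have [ci|ci] := eqVneq c i.
    left; move: E; rewrite ci => /F_inj /(Fword_eq_q _ _ _ (triangle_q a))[-> /q_inj ->].
    by rewrite sw.
  have [cj|cj] := eqVneq c j.
    right; move: E; rewrite cj F_qC => /F_inj /(Fword_eq_q _ _ _ (triangle_q a))[-> /q_inj ->].
    by rewrite sw.
  have := F_overlap _ _ _ _ _ (triangle_q j) tw (esym E).
  by rewrite eq_sym => /(_ ci) /q_inj jc; rewrite jc eqxx in cj.
- have [cd|cd] := eqVneq c d.
    move: E; rewrite cd => /F_inj /IH[]; first by rewrite sw addn1 addSn.
      by move=> [-> ->]; left.
    by move=> [-> ->]; right.
  have tv : in_triangle (Fword v (F i (q j))) by exact/triangle_Fword/triangle_F/triangle_q.
  have tw : in_triangle (Fword w (q a)) by exact/triangle_Fword/triangle_q.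
  have := F_overlap _ _ _ _ _ tv tw (esym E); rewrite eq_sym => /(_ cd).
  move=> /(Fword_eq_q _ _ _ (triangle_F _ _ (triangle_q j)))[_].
  move=> /(F_eq_q _ _ _ (triangle_q j))[ic /q_inj jc].
  by rewrite ic jc eqxx in ij.
Qed.

(** The normal derivative at a corner without its renormalizing power of 5/3; the term [a = j] is
    0. *)
Definition cell_flux (u : plane R -> R) w j : R :=
  \sum_a (u (Fword w (q j)) - u (Fword w (q a))).

Lemma cell_fluxE u w j a b : uniq [:: j; a; b] ->
  cell_flux u w j = 2 * u (Fword w (q j)) - u (Fword w (q a)) - u (Fword w (q b)).
Proof. by move=> /ord3_sum; rewrite /cell_flux => ->; ring. Qed.

Lemma junction_laplacian (u : plane R -> R) v i j k : i != j ->
  graph_laplacian (size v + 1 + k) u (Fword v (F i (q j))) =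
  - (cell_flux u (v ++ i :: nseq k j) j + cell_flux u (v ++ j :: nseq k i) i).
Proof.
move=> ij; set p := Fword v (F i (q j)); set wi := v ++ _; set wj := v ++ _.
have pi : Fword wi (q j) = p by rewrite Fword_cat /= Fword_nseq_q.
have pj : Fword wj (q i) = p by rewrite Fword_cat /= Fword_nseq_q F_qC.
have si : size wi = (size v + 1 + k)%N by rewrite size_cat/= size_nseq addn1 addSnnS.
have sj : size wj = (size v + 1 + k)%N by rewrite size_cat/= size_nseq addn1 addSnnS.
(* The four neighbours of the junction, two in each of the cells that meet there. *)
pose r : seq (plane R) := [seq Fword wi (q a) | a <- index_enum 'I_3 & a != j] ++
          [seq Fword wj (q a) | a <- index_enum 'I_3 & a != i].
have -> : graph_laplacian (size v + 1 + k) u p = \sum_(p' <- r) (u p' - u p).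
  rewrite /graph_laplacian (@fsbig_seq _ _ _ _ r).
    congr (\big[_/_]_(_ \in _) _); apply/seteqP; split => p' /=.
    - move=> [p'p [w [a [b [pE p'E]]]]].
      have [[wE aE]|[wE aE]] := Fword_junction v i j k w a ij (size_tuple w) (esym pE).
      + rewrite mem_cat; apply/orP; left; apply/mapP; exists b; last by rewrite p'E wE.
        rewrite mem_filter mem_index_enum andbT; apply/eqP => bj.
        by apply: p'p; rewrite p'E pE aE bj.
      + rewrite mem_cat; apply/orP; right; apply/mapP; exists b; last by rewrite p'E wE.
        rewrite mem_filter mem_index_enum andbT; apply/eqP => bi.
        by apply: p'p; rewrite p'E pE aE bi.
    - rewrite mem_cat => /orP[|] /mapP[a]; rewrite mem_filter => /andP[aj _] ->.
      + split; first by rewrite -pi => /Fword_inj /q_inj aE; rewrite aE eqxx in aj.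
        by exists (Tuple (introT eqP si)), j, a; rewrite /= pi.
      + split; first by rewrite -pj => /Fword_inj /q_inj aE; rewrite aE eqxx in aj.
        by exists (Tuple (introT eqP sj)), i, a; rewrite /= pj.
  rewrite cat_uniq !map_inj_uniq ?filter_uniq ?index_enum_uniq//=; last 2 first.
    by move=> ? ? /Fword_inj /q_inj.
    by move=> ? ? /Fword_inj /q_inj.
  (* A common neighbour would lie in both cells, hence be the junction itself, which both lists
     omit. *)
  rewrite andbT; apply/hasPn => _ /mapP[a _ ->]; apply/negP => /mapP[b].
  rewrite mem_filter => /andP[bj _]; rewrite !Fword_cat/= => /Fword_inj E.
  have tr k' i' a' : in_triangle (Fword (nseq k' i') (q a') : plane R).
    exact/triangle_Fword/triangle_q.
  have := F_overlap _ _ _ _ ij (tr _ _ _) (tr _ _ _) (esym E).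
  by move=> /(Fword_eq_q _ _ _ (triangle_q b))[_ /q_inj bE]; rewrite bE eqxx in bj.
rewrite big_cat/= !big_map !big_filter /cell_flux pi pj opprD -!sumrN.
congr (_ + _); [rewrite [RHS](bigD1 j)//= pi|rewrite [RHS](bigD1 i)//= pj].
  by rewrite subrr oppr0 add0r; apply: eq_bigr => a _; rewrite opprB.
by rewrite subrr oppr0 add0r; apply: eq_bigr => a _; rewrite opprB.
Qed.

Definition midpoint_flux u w i j : R :=
  cell_flux u (rcons w i) j + cell_flux u (rcons w j) i.

Lemma midpoint_fluxC u w i j : midpoint_flux u w i j = midpoint_flux u w j i.
Proof. exact: addrC. Qed.

(* Eliminating the three midpoint values; the coefficients 2/5, 2/5, 1/5 are
   those of the harmonic extension rule. *)
Lemma cell_flux_step u w j a b : uniq [:: j; a; b] ->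
  cell_flux u w j = 5 / 3 * (cell_flux u (rcons w j) j +
    (2 * midpoint_flux u w j a + 2 * midpoint_flux u w j b + midpoint_flux u w a b) / 5).
Proof.
move=> u1; have u2 : uniq [:: a; j; b] by move: u1; rewrite /= !inE -!val_eqE /=; lia.
have u3 : uniq [:: b; j; a] by move: u1; rewrite /= !inE -!val_eqE /=; lia.
rewrite /midpoint_flux !(cell_fluxE _ _ _ _ _ u1) !(cell_fluxE _ _ _ _ _ u2).
rewrite !(cell_fluxE _ _ _ _ _ u3) !Fword_rcons !F_q (F_qC a j) (F_qC b j) (F_qC b a).
by field.
Qed.

End Barycentric.

Section Gasket.
Context {R : realType} (SG : set (plane R)) (gSG : is_gasket SG).

Lemma gasket_F i p : SG p -> SG (F i p).
Proof. by case: gSG => _ _ SGE pSG; rewrite SGE; exists i => //; exists p. Qed.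

Lemma gasket_Fword w p : SG p -> SG (Fword w p).
Proof. by move=> pSG; elim: w => //= i w IH; exact: gasket_F. Qed.

Lemma gasketE p : SG p -> exists i p', SG p' /\ p = F i p'.
Proof.
by case: gSG => _ _ {1}-> [i _ [p' SGp' <-]]; exists i, p'.
Qed.

(** At a minimizer [c = F j c'] of a coordinate over the compact gasket, the value at [c] is at
    least half the value at [c'], hence at least half itself, so the minimum is nonnegative. *)
Lemma gasket_triangle p : SG p -> in_triangle p.
Proof.
case: (gSG) => SG0 cSG _ SGp i.
have [c /set_mem SGc cmin] := compact_EVT_min SG0 cSG
  (continuous_subspaceT (bary_continuous i)).
have := cmin p (mem_set SGp); apply: le_trans.
have [j [c' [SGc' cE]]] := gasketE c SGc.
by have := cmin c' (mem_set SGc'); rewrite cE bary_F; have := ler0n R (i == j); lra.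
Qed.

(** A maximizer of the i-th coordinate is not improved by [F i], which forces the maximum to be 1,
    attained only at the corner. *)
Lemma gasket_q i : SG (q i).
Proof.
case: (gSG) => SG0 cSG _.
have [c /set_mem SGc cmax] := compact_EVT_max SG0 cSG
  (continuous_subspaceT (bary_continuous i)).
rewrite -(bary_eq1 i c)//; first exact: gasket_triangle.
by have := cmax (F i c) (mem_set (gasket_F i c SGc)); rewrite bary_F eqxx mulr1n; lra.
Qed.

Lemma cell_compact w : compact (Fword w @` SG).
Proof.
case: (gSG) => _ cSG _; apply: continuous_compact => //.
by apply: continuous_subspaceT; exact: Fword_continuous.
Qed.

End Gasket.

(** * From pointwise harmonicity to exact graph harmonicity *)

Section ExactHarmonicity.
Context {R : realType} (SG : set (plane R)) (gSG : is_gasket SG).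
Implicit Types (u : plane R -> R) (i j a b : 'I_3) (w v : seq 'I_3).

Definition junction_flux u v i j k : R :=
  cell_flux u (v ++ i :: nseq k j) j + cell_flux u (v ++ j :: nseq k i) i.

Lemma ord3_others j : exists a b, uniq [:: j; a; b].
Proof.
by exists (lift j ord0), (lift j ord_max); case: j => -[|[|[|//]]].
Qed.

Lemma uniq3_neq j a b : uniq [:: j; a; b] -> [/\ j != a, j != b & a != b].
Proof. by rewrite /= !inE negb_or andbT => /andP[/andP[-> ->] ->]. Qed.

Lemma rcons_junction v i j k : rcons (v ++ i :: nseq k j) j = v ++ i :: nseq k.+1 j.
Proof. by rewrite rcons_cat /= -cats1 -[[:: j]]/(nseq 1 j) -nseqD addn1. Qed.

Lemma cell_sub w v : Fword (w ++ v) @` SG `<=` Fword w @` SG.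
Proof.
by move=> _ [p SGp <-]; rewrite Fword_cat; exists (Fword v p) => //; exact: gasket_Fword.
Qed.

(* Passing to the next level divides a uniform bound on the graph Laplacians
   by exactly 5, so [5^m * Delta_m u] cannot increase as m decreases. *)
Lemma junction_flux_bound u (C : set (plane R)) (N : nat) (e : R) :
  (forall m, (N <= m)%N -> forall p, vertices m p -> C p ->
     `|3 / 2 * 5 ^+ m * graph_laplacian m u p| <= e) ->
  forall d v i j k, i != j -> (N <= size v + 1 + k + d)%N ->
  Fword (v ++ i :: nseq k j) @` SG `<=` C -> Fword (v ++ j :: nseq k i) @` SG `<=` C ->
  `|3 / 2 * 5 ^+ (size v + 1 + k) * junction_flux u v i j k| <= e.
Proof.
move=> NC; elim=> [|d IH] v i j k ij; rewrite ?addn0 => Nk Ci Cj.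
  rewrite -normrN -mulrN -junction_laplacian//; apply: NC => //.
    have si : size (v ++ i :: nseq k j) == (size v + 1 + k)%N.
      by rewrite size_cat/= size_nseq addn1 addSnnS.
    by exists (Tuple si), j; rewrite /= Fword_cat/= Fword_nseq_q.
  by apply: Ci; exists (q j); [exact: gasket_q|rewrite Fword_cat/= Fword_nseq_q].
rewrite addnS -addSn -addnS in Nk.
set m := (size v + 1 + k)%N in Nk *.
have B w s a b : size w = m -> uniq [:: s; a; b] -> Fword w @` SG `<=` C ->
    `|3 / 2 * 5 ^+ m.+1 *
       (2 * midpoint_flux u w s a + 2 * midpoint_flux u w s b + midpoint_flux u w a b)|
      <= 5 * e.
  move=> sw /uniq3_neq[sa sb ab] Cw.
  have sub l : Fword (rcons w l) @` SG `<=` C.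
    by rewrite -cats1; apply: subset_trans Cw; exact: cell_sub.
  have M s' t : s' != t -> `|3 / 2 * 5 ^+ m.+1 * midpoint_flux u w s' t| <= e.
    move=> st; have := IH w s' t 0%N st; rewrite !cats1 addn0 addn1 sw.
    rewrite /junction_flux !cats1; apply => //.
    by rewrite (leq_trans Nk)// /m !addnS !addSn.
  have := M _ _ sa; have := M _ _ sb; have := M _ _ ab.
  set X := 3 / 2 * _; rewrite !ler_norml => /andP[? ?] /andP[? ?] /andP[? ?].
  apply/andP; split; lra.
have [a [b jab]] := ord3_others j; have [a' [b' iab]] := ord3_others i.
have swi : size (v ++ i :: nseq k j) = m by rewrite size_cat/= size_nseq /m addn1 addSnnS.
have swj : size (v ++ j :: nseq k i) = m by rewrite size_cat/= size_nseq /m addn1 addSnnS.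
have Bi := B _ _ _ _ swi jab Ci; have Bj := B _ _ _ _ swj iab Cj.
have subi : Fword (v ++ i :: nseq k.+1 j) @` SG `<=` C.
  by rewrite -rcons_junction -cats1; apply: subset_trans Ci; exact: cell_sub.
have subj : Fword (v ++ j :: nseq k.+1 i) @` SG `<=` C.
  by rewrite -rcons_junction -cats1; apply: subset_trans Cj; exact: cell_sub.
have Nd : (N <= size v + 1 + k.+1 + d)%N by rewrite (leq_trans Nk).
(* As 5^m * 5/3 is a third of 5^(m+1), the next junction and the two correction terms, each of which
   is bounded by [e] after the division by 5, add up to [e]. *)
have := IH v i j k.+1 ij Nd subi subj.
rewrite addnS -/m [junction_flux u v i j k]/junction_flux.
rewrite (cell_flux_step _ _ _ _ _ jab) (cell_flux_step _ _ _ _ _ iab).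
rewrite !rcons_junction [junction_flux _ _ _ _ _]/junction_flux.
move: Bi Bj; rewrite !exprS.
set X := _ ^+ m; set Z1 := _ + midpoint_flux _ _ _ _; set Z2 := _ + midpoint_flux _ _ _ _.
set Y1 := cell_flux _ _ _; set Y2 := cell_flux _ _ _.
rewrite !ler_norml => /andP[? ?] /andP[? ?] /andP[? ?].
apply/andP; split; lra.
Qed.

(** The rescaled Laplacians become smaller than any [e] at fine levels, and [junction_flux_bound]
    brings the bound back to the given level, so the flux is exactly 0. *)
Lemma harmonic_junction (U : set (plane R)) u v i j k : Defs.harmonic U u -> i != j ->
  Fword (v ++ i :: nseq k j) @` SG `<=` U -> Fword (v ++ j :: nseq k i) @` SG `<=` U ->
  junction_flux u v i j k = 0.
Proof.
move=> [_ _ lap] ij Ui Uj.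
pose C := (Fword (v ++ i :: nseq k j) @` SG) `|` (Fword (v ++ j :: nseq k i) @` SG).
have cC : compact C by apply: compactU; exact: cell_compact.
have CU : C `<=` U by move=> p [/Ui|/Uj].
have nz : 3 / 2 * 5 ^+ (size v + 1 + k) != 0 :> R.
  by rewrite mulf_neq0 ?expf_neq0 ?pnatr_eq0//; apply/lt0r_neq0; lra.
apply/eqP; rewrite -(mulrI_eq0 _ (lregP nz)) -normr_eq0 eq_le normr_ge0 andbT.
apply/ler_addgt0Pr => e e0; rewrite add0r.
have [N _ NC] := lap C cC CU e e0.
apply: (junction_flux_bound u C N e _ N) => //; first last.
- by move=> p ?; right.
- by move=> p ?; left.
- by rewrite leq_addl.
by move=> m Nm p mp Cp; have := NC m Nm p mp Cp; rewrite /= subr0.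
Qed.

Lemma Fword_fst w (p p' : plane R) :
  (Fword w p).1 - (Fword w p').1 = 2 ^- size w * (p.1 - p'.1).
Proof.
elim: w => [|i w IH] /=; first by rewrite expr0 invr1 mul1r.
by rewrite exprS invfM -mulrA -IH; field.
Qed.

Lemma Fword_snd w (p p' : plane R) :
  (Fword w p).2 - (Fword w p').2 = 2 ^- size w * (p.2 - p'.2).
Proof.
elim: w => [|i w IH] /=; first by rewrite expr0 invr1 mul1r.
by rewrite exprS invfM -mulrA -IH; field.
Qed.

Lemma triangle_dist (p p' : plane R) : in_triangle p -> in_triangle p' ->
  `|p.1 - p'.1| <= 2 /\ `|p.2 - p'.2| <= 2.
Proof.
move=> tp tp'.
have := tp ord0; have := tp (lift ord0 ord0); have := tp ord_max.
have := tp' ord0; have := tp' (lift ord0 ord0); have := tp' ord_max.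
rewrite /bary/= => h1 h2 h3 h4 h5 h6.
split; last by rewrite ler_norml; apply/andP; split; lra.
have s1 : 1 <= Num.sqrt 3 :> R by rewrite -[leLHS]sqrtr1 ler_sqrt; lra.
have H (t : R) : `|Num.sqrt 3 * t| <= 2 -> `|t| <= 2.
  rewrite normrM (ger0_norm (le_trans ler01 s1)).
  have : 0 <= (Num.sqrt 3 - 1) * `|t| by apply: mulr_ge0 => //; lra.
  lra.
by apply: H; rewrite ler_norml; apply/andP; split; lra.
Qed.

(** Cells containing [P] shrink at least like [2 ^- k], so continuity at [P] controls [u] at all
    their points in [X]. *)
Lemma within_cvg_cells (X : set (plane R)) u (w : nat -> seq 'I_3) (P : plane R) :
  {within X, continuous u} -> X P -> (forall k, (k <= size (w k))%N) ->
  (forall k, exists2 p, in_triangle p & P = Fword (w k) p) ->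
  forall e : R, 0 < e -> \forall k \near \oo, forall p, in_triangle p ->
    X (Fword (w k) p) -> `|u (Fword (w k) p) - u P| <= e.
Proof.
move=> /subspace_continuousP cu XP sw wP e e0.
have /cvgrPdist_le/(_ e e0) := cu P XP.
rewrite near_withinE => /nbhs_ballP[d /= d0 dP].
have d4 : 0 < d / 4 by lra.
have [N _ NP] := near_infty_natSinv_expn_lt (PosNum d4).
exists N => // k Nk p tp Xp.
have [p' tp' PE] := wP k.
rewrite distrC; apply: dP => //.
have [h1 h2] := triangle_dist _ _ tp' tp.
have lt : 2 ^- size (w k) < d / 4.
  have := NP k Nk; rewrite /= div1r; apply: le_lt_trans.
  by rewrite exp2V_le.
have p0 := exp2V_gt0 (R := R) (size (w k)).
have B (t : R) : `|t| <= 2 -> `|2 ^- size (w k) * t| < d.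
  move=> t2; rewrite normrM (gtr0_norm p0).
  have : 0 <= 2 ^- size (w k) * (2 - `|t|) by apply: mulr_ge0; [exact: ltW|lra].
  lra.
by rewrite PE; split; rewrite /ball/= ?Fword_fst ?Fword_snd; exact: B.
Qed.

End ExactHarmonicity.

(** * Cells above the line *)

Section LineCells.
Context {R : realType} (SG : set (plane R)) (gSG : is_gasket SG).
Context (x : R) (x01 : 0 < x < 1) (xnd : nondyadic x).
Let n := expo x.
Implicit Types (u : plane R -> R) (p P : plane R).

Let n_incr k : (n k < n k.+1)%N. Proof. exact: expo_incr. Qed.
Let n0 : n 0 = 0%N.
Proof. by case/andP: x01 => x0 x1; case: (expoP x); rewrite ?x0 ?ltW. Qed.

Fixpoint line_word_from (k : nat) (w : seq 'I_2) : seq 'I_3 :=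
  if w is i :: w' then
    nseq (n k.+1 - n k).-1 ord0 ++ letter i :: line_word_from k.+1 w'
  else [::].

Definition line_word w := line_word_from 0 w.

(* The largest cell with the same top vertex as [tF x w @` SG] lying above the line. *)
Definition lead_word w := line_word w ++ nseq (n (size w).+1 - n (size w)) ord0.

Lemma iter_F i k p : iter k (F i) p = Fword (nseq k i) p.
Proof. by elim: k => //= k ->. Qed.

Lemma tFE w p : tF x w p = Fword (line_word w) p.
Proof.
rewrite /tF /line_word; elim: w 0%N p => //= i w IH k p.
by rewrite iter_F Fword_cat/= IH.
Qed.

Lemma line_word_rcons w i :
  line_word (rcons w i) =
  line_word w ++ nseq (n (size w).+1 - n (size w)).-1 ord0 ++ [:: letter i].
Proof.
suff H k : line_word_from k (rcons w i) = line_word_from k w ++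
    nseq (n (k + size w).+1 - n (k + size w)).-1 ord0 ++ [:: letter i] by exact: H 0%N.
elim: w k => [|c w IH] k /=; first by rewrite addn0.
by rewrite IH -catA/= addSnnS.
Qed.

Lemma line_word_take k w : exists v, line_word w = line_word (take k w) ++ v.
Proof.
elim/last_ind: w => [|w i [v E]]; first by exists [::].
have [kw|wk] := leqP k (size w); last first.
  by exists [::]; rewrite cats0 take_oversize// size_rcons.
rewrite -cats1 takel_cat// cats1 line_word_rcons {1}E -catA; by eexists.
Qed.

Lemma size_line_word w : size (line_word w) = n (size w).
Proof.
elim/last_ind: w => [|w i IH]; first by rewrite n0.
rewrite line_word_rcons !size_cat IH size_nseq size_rcons /=.
by have := n_incr (size w); lia.
Qed.

Lemma depthE p : depth p = 1 - bary ord0 p.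
Proof. by []. Qed.

Lemma depth_F0 k p : depth (Fword (nseq k ord0) p) = 2 ^- k * depth p.
Proof.
elim: k => [|k IH] /=; first by rewrite expr0 invr1 mul1r.
rewrite depthE bary_F eqxx mulr1n exprS invfM -mulrA -IH depthE; lra.
Qed.

Lemma depth_letter i p : depth (F (letter i) p) = (1 + depth p) / 2.
Proof. by rewrite !depthE bary_F mulr0n; lra. Qed.

Lemma depth_ge0 p : in_triangle p -> 0 <= depth p.
Proof. by move=> /(bary_le1 ord0); rewrite depthE; lra. Qed.

Lemma depth_le1 p : in_triangle p -> depth p <= 1.
Proof. by move=> /(_ ord0); rewrite depthE; lra. Qed.

Lemma depth_line_word w p :
  depth (Fword (line_word w) p) = binary_partial n (size w) + 2 ^- n (size w) * depth p.
Proof.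
elim/last_ind: w p => [|w i IH] p.
  by rewrite /binary_partial big_geq// n0 expr0 invr1 mul1r add0r.
rewrite line_word_rcons Fword_cat IH Fword_cat depth_F0 depth_letter size_rcons.
rewrite binary_partialS -addrA; congr (_ + _).
have -> : 2 ^+ n (size w).+1 = 2 ^+ n (size w) * (2 ^+ (n (size w).+1 - n (size w)).-1 * 2) :> R.
  by rewrite -exprSr -exprD; congr (_ ^+ _); have := n_incr (size w); lia.
by rewrite !invfM; field; rewrite !expf_neq0// ?pnatr_eq0.
Qed.

Definition above w := Fword w @` SG `<=` Omega SG x.

Lemma above_cat w v : above w -> above (w ++ v).
Proof. by apply: subset_trans; exact: cell_sub. Qed.

Lemma above_rcons w i : above w -> above (rcons w i).
Proof. by rewrite -cats1; exact: above_cat. Qed.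

Lemma above_lead_word w : above (lead_word w).
Proof.
move=> _ [p SGp <-]; split; first exact: gasket_Fword.
rewrite Fword_cat depth_line_word depth_F0 mulrA -invfM -exprD subnKC; last exact: ltnW.
have tp := gasket_triangle SG gSG p SGp; have [lo _] := remainder_bounds x x01 xnd (size w).
have : 0 <= 2 ^- n (size w).+1 * (1 - depth p).
  by apply: mulr_ge0; [exact/ltW/exp2V_gt0|rewrite subr_ge0 depth_le1].
rewrite -/n in lo *; lra.
Qed.

Lemma q0_notin_cell w : w != nseq (size w) ord0 -> ~ (Fword w @` SG) (q ord0).
Proof.
move=> /eqP wn [p SGp]; move=> /(Fword_eq_q _ _ _ (gasket_triangle _ gSG _ SGp))[wE _].
exact: wn.
Qed.

Lemma x_gt0 : 0 < x. Proof. by case/andP: x01. Qed.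

Lemma depth_q0 : depth (q ord0 : plane R) = 0.
Proof. by rewrite depthE bary_q eqxx subrr. Qed.

(** * Fluxes of a harmonic function in the cells above the line *)

Section Harmonic.
Context (u : plane R -> R) (hu : Defs.harmonic (Omega SG x `\ q ord0) u).
Context (cu : {within Omega SG x `|` Sx SG x, continuous u}).

(** The conditions on the two words keep [q ord0] out of both cells, as harmonicity is given only
    away from that point. *)
Lemma above_junction v i j k : i != j ->
  above (v ++ i :: nseq k j) -> above (v ++ j :: nseq k i) ->
  v ++ i :: nseq k j != nseq (size v + k.+1) ord0 ->
  v ++ j :: nseq k i != nseq (size v + k.+1) ord0 ->
  junction_flux u v i j k = 0.
Proof.
move=> ij Ai Aj i0 j0; apply: (harmonic_junction SG gSG _ u v i j k hu ij).
  move=> p Cp; split; first exact: Ai.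
  move=> pq; move: Cp; rewrite pq; apply: q0_notin_cell.
  by rewrite size_cat /= size_nseq.
move=> p Cp; split; first exact: Aj.
move=> pq; move: Cp; rewrite pq; apply: q0_notin_cell.
by rewrite size_cat /= size_nseq.
Qed.

Lemma cat_neq_nseq (v : seq 'I_3) i k l : i != ord0 -> v ++ i :: nseq k l != nseq (size v + k.+1) ord0.
Proof.
move=> i0; apply/eqP => /(congr1 (fun s => i \in s)).
by rewrite mem_cat mem_head orbT mem_nseq (negbTE i0) andbF.
Qed.

Lemma cat_neq_nseq_l (v : seq 'I_3) i k l m : v != nseq (size v) ord0 -> v ++ i :: nseq k l != nseq m ord0.
Proof.
move=> v0; apply/eqP => E; move/eqP: v0; apply.
have := congr1 (take (size v)) E; rewrite take_size_cat// => {1}->.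
have := congr1 size E; rewrite size_cat size_nseq => <-.
by rewrite take_nseq// leq_addr.
Qed.

Lemma above_midpoint_away w i j : i != j -> above w ->
  (w != nseq (size w) ord0) || ((i != ord0) && (j != ord0)) ->
  midpoint_flux u w i j = 0.
Proof.
move=> ij Aw H; have := above_junction w i j 0 ij; rewrite /junction_flux !cats1.
have nz k : (w != nseq (size w) ord0) || (k != ord0) -> rcons w k != nseq (size w + 1) ord0.
  by rewrite -cats1 => /orP[?|?]; [exact: (cat_neq_nseq_l w k 0 k)|exact: (cat_neq_nseq w k 0 k)].
by apply; do ?exact: above_rcons; apply: nz; case/orP: H => [->|/andP[i0 j0]] //; rewrite ?i0 ?j0 orbT.
Qed.

Lemma cell_flux_le (c e : R) w j :
  (forall a, `|u (Fword w (q a)) - c| <= e) -> `|cell_flux u w j| <= 4 * e.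
Proof.
move=> H; have [a [b jab]] := ord3_others j; rewrite (cell_fluxE _ _ _ _ _ jab).
move: (H j) (H a) (H b); rewrite !ler_norml => /andP[? ?] /andP[? ?] /andP[? ?].
apply/andP; split; lra.
Qed.

(** Expand both fluxes by [cell_flux_step]. The deeper junction and the midpoints away from [q ord0]
    drop out; the two upper midpoints of the next cell remain, with weights 2/3 and 1/3. *)
Lemma top_midpoint_step l i j : uniq [:: ord0; i; j] -> above (nseq l ord0) ->
  midpoint_flux u (nseq l ord0) ord0 i =
  (2 * midpoint_flux u (nseq l.+1 ord0) ord0 i + midpoint_flux u (nseq l.+1 ord0) ord0 j) / 3.
Proof.
move=> u0 Al; have [i0 j0 ij] := uniq3_neq _ _ _ u0.
have ui : uniq [:: i; ord0; j] by rewrite /= !inE (eq_sym i) negb_or i0 ij j0.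
have rl : rcons (nseq l ord0) ord0 = nseq l.+1 (ord0 : 'I_3).
  by rewrite -cats1 -[[:: _]]/(nseq 1 _) -nseqD addn1.
have Al1 : above (nseq l.+1 ord0) by rewrite -rl; exact: above_rcons.
have Ai : above (rcons (nseq l ord0) i) by exact: above_rcons.
have i0' : i != ord0 by rewrite eq_sym.
have j0' : j != ord0 by rewrite eq_sym.
have nz : rcons (nseq l ord0) i != nseq (size (rcons (nseq l ord0) i)) ord0.
  rewrite -cats1 size_cat size_nseq /=.
  by have := cat_neq_nseq (nseq l ord0) i 0 ord0 i0'; rewrite size_nseq.
have E0 : nseq l ord0 ++ ord0 :: nseq 1 i = rcons (nseq l.+1 ord0) i.
  by rewrite -cat_rcons rl cats1.
have Ei : nseq l ord0 ++ i :: nseq 1 ord0 = rcons (rcons (nseq l ord0) i) ord0.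
  by rewrite -cat_rcons cats1.
have J : cell_flux u (rcons (nseq l.+1 ord0) i) i +
    cell_flux u (rcons (rcons (nseq l ord0) i) ord0) ord0 = 0.
  rewrite -E0 -Ei; apply: (above_junction (nseq l ord0) ord0 i 1) => //.
  - by rewrite E0; exact: above_rcons.
  - by rewrite Ei; exact: above_rcons.
  - rewrite E0 -cats1 size_nseq addn2 -(addn1 l.+1).
    by have := cat_neq_nseq (nseq l.+1 ord0) i 0 i i0'; rewrite size_nseq.
  - exact: cat_neq_nseq.
rewrite /midpoint_flux rl (cell_flux_step _ _ _ _ _ ui) (cell_flux_step _ (rcons _ _) _ _ _ u0).
rewrite (above_midpoint_away (nseq l.+1 ord0) i j ij) ?i0' ?j0' ?orbT//.
rewrite !(above_midpoint_away (rcons (nseq l ord0) i)) ?nz//.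
rewrite (midpoint_fluxC u _ i ord0) -/(midpoint_flux u _ _ _) -/(midpoint_flux u _ ord0 j).
lra.
Qed.

Lemma top_in_domain w p : above w -> SG p -> (Omega SG x `|` Sx SG x) (Fword w p).
Proof. by move=> Aw SGp; left; apply: Aw; exists p. Qed.

(* The point q0 is a removable singularity: the fluxes at the two corners
   F0^l q1, F0^l q2 are averages of those at level l + 1, which vanish in the
   limit because u is continuous at q0. *)
Lemma top_midpoint l i : i != ord0 -> above (nseq l ord0) ->
  midpoint_flux u (nseq l ord0) ord0 i = 0.
Proof.
move=> i0 Al; apply/eqP; rewrite -normr_eq0 eq_le normr_ge0 andbT.
apply/ler_addgt0Pr => e e0; rewrite add0r.
(* Each of the two cell fluxes is at most four times the oscillation bound, and 2 * 4 * (e / 8) =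
   e. *)
have e8 : 0 < e / 8 by lra.
have X0 : (Omega SG x `|` Sx SG x) (q ord0).
  by left; split; [exact: gasket_q|rewrite depth_q0 x_gt0].
have [|k|N _ HN] := within_cvg_cells _ _ (fun k => nseq k ord0) _ cu X0 _ _ _ e8.
- by move=> k; rewrite size_nseq.
- by exists (q ord0); [exact: triangle_q|rewrite Fword_nseq_q].
suff H d l' : above (nseq l' ord0) -> (N <= l' + d)%N -> forall i', i' != ord0 ->
    `|midpoint_flux u (nseq l' ord0) ord0 i'| <= e.
  by apply: (H N) => //; rewrite leq_addl.
elim: d l' => [|d IH] l' Al' Nl i' i'0.
  have B k j : above (rcons (nseq l' ord0) k) ->
      `|cell_flux u (rcons (nseq l' ord0) k) j| <= 4 * (e / 8).
    move=> Ak; apply: (cell_flux_le (u (q ord0))) => a.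
    rewrite addn0 in Nl; have := HN l' Nl (F k (q a)); rewrite Fword_rcons; apply.
      exact/triangle_F/triangle_q.
    by apply: top_in_domain => //; apply: gasket_F => //; exact: gasket_q.
  rewrite /midpoint_flux; apply: le_trans (ler_normD _ _) _.
  have := B ord0 i' (above_rcons _ _ Al'); have := B i' ord0 (above_rcons _ _ Al').
  lra.
have [j uj] : exists j, uniq [:: ord0; i'; j].
  case: i' i'0 => -[|[|[|//]]] ? // _.
    by exists ord_max.
  by exists (lift ord0 ord0).
have [_ j0 _] := uniq3_neq _ _ _ uj; rewrite eq_sym in j0.
have rl : rcons (nseq l' ord0) ord0 = nseq l'.+1 (ord0 : 'I_3).
  by rewrite -cats1 -[[:: _]]/(nseq 1 _) -nseqD addn1.
have Al1 : above (nseq l'.+1 ord0) by rewrite -rl; exact: above_rcons.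
rewrite (top_midpoint_step _ _ _ uj Al').
have N1 : (N <= l'.+1 + d)%N by rewrite addSnnS.
have := IH _ Al1 N1 i' i'0; have := IH _ Al1 N1 j j0.
rewrite !ler_norml => /andP[? ?] /andP[? ?]; apply/andP; split; lra.
Qed.

Lemma above_midpoint w i j : i != j -> above w -> midpoint_flux u w i j = 0.
Proof.
move=> ij Aw; have [wE|w0] := eqVneq w (nseq (size w) ord0); last first.
  by apply: above_midpoint_away => //; rewrite w0.
have [i0|i0] := eqVneq i ord0.
  by rewrite i0 wE; apply: top_midpoint; rewrite -?wE// eq_sym -i0.
have [j0|j0] := eqVneq j ord0.
  by rewrite midpoint_fluxC j0 wE; apply: top_midpoint; rewrite -?wE// -j0.
by apply: above_midpoint_away; rewrite ?i0 ?j0 ?orbT.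
Qed.

(** All midpoint corrections in [cell_flux_step] vanish, leaving the exact 3/5 scaling. *)
Lemma cell_flux_nseq w j k : above w ->
  cell_flux u (w ++ nseq k j) j = (3 / 5) ^+ k * cell_flux u w j.
Proof.
elim: k w => [|k IH] w Aw; first by rewrite cats0 expr0 mul1r.
rewrite -[nseq k.+1 j]/([:: j] ++ nseq k j) catA cats1 IH ?exprSr; last exact: above_rcons.
have [a [b jab]] := ord3_others j; have [ja jb ab] := uniq3_neq _ _ _ jab.
by rewrite (cell_flux_step _ w _ _ _ jab) !above_midpoint//; field.
Qed.

(** With zero corners, the three midpoint equations form a linear system whose only solution is 0;
    then descend along [v]. *)
Lemma corners_eq0 w v a : above w -> (forall b : 'I_3, u (Fword w (q b)) = 0) ->
  u (Fword (w ++ v) (q a)) = 0.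
Proof.
elim: v w => [|i v IH] w Aw w0; first by rewrite cats0.
rewrite -[i :: v]/([:: i] ++ v) catA cats1; apply: IH => [|{}a]; first exact: above_rcons.
rewrite Fword_rcons; have [->|ai] := eqVneq a i; first by rewrite F_q.
have [b ub] : exists b, uniq [:: i; a; b].
  have [c [d icd]] := ord3_others i; have := ord3_mem i c d a icd.
  rewrite !inE (negbTE ai)/= => /orP[/eqP->|/eqP->]; first by exists d.
  by exists c; move: icd; rewrite /= !inE !negb_or (eq_sym d c) andbT => /andP[/andP[-> ->] ->].
have [ia ib ab] := uniq3_neq _ _ _ ub.
have u2 : uniq [:: a; i; b] by rewrite /= !inE (eq_sym a i) negb_or ia ab ib.
have u3 : uniq [:: b; i; a].
  by rewrite /= !inE (eq_sym b i) (eq_sym b a) negb_or ib ab ia.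
have := above_midpoint w i a ia Aw; have := above_midpoint w i b ib Aw.
have := above_midpoint w a b ab Aw.
rewrite /midpoint_flux !(cell_fluxE _ _ _ _ _ ub) !(cell_fluxE _ _ _ _ _ u2).
rewrite !(cell_fluxE _ _ _ _ _ u3) !Fword_rcons !F_q (F_qC a i) (F_qC b i) (F_qC b a) !w0.
lra.
Qed.

Definition tops w := u (Fword (line_word w) (q ord0)).

(** The bottom corners of the lead cell are the tops of the two children: this is what turns the
    gasket above the line into a tree. *)
Lemma lead_word_letter w i :
  Fword (lead_word w) (q (letter i)) = Fword (line_word (rcons w i)) (q ord0) :> plane R.
Proof.
rewrite /lead_word line_word_rcons !Fword_cat/=.
have := n_incr (size w); rewrite -subn_gt0; case: (_ - _)%N => // d _ /=.
by rewrite (F_qC (letter i)) -!iter_F -iterSr.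
Qed.

Lemma lead_word_ord0 w : Fword (lead_word w) (q ord0) = Fword (line_word w) (q ord0) :> plane R.
Proof. by rewrite /lead_word Fword_cat Fword_nseq_q. Qed.

Lemma letter_uniq i : uniq [:: ord0; letter i; letter (rev_ord i)].
Proof. by have [->|->] := ord2P i. Qed.

Lemma lead_flux_top w :
  cell_flux u (lead_word w) ord0 =
  2 * tops w - tops (rcons w letter1) - tops (rcons w letter2).
Proof.
rewrite (cell_fluxE _ _ _ _ _ (letter_uniq letter1)) lead_word_ord0 !lead_word_letter.
by rewrite rev_letter1.
Qed.

Lemma lead_flux_letter w i :
  cell_flux u (lead_word w) (letter i) =
  2 * tops (rcons w i) - tops w - tops (rcons w (rev_ord i)).
Proof.
have ui : uniq [:: letter i; ord0; letter (rev_ord i)] by have [->|->] := ord2P i.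
by rewrite (cell_fluxE _ _ _ _ _ ui) lead_word_ord0 !lead_word_letter.
Qed.

(** The top of a child is a junction of the lead cells of parent and child; scaling the parent's
    flux down to the child's level gives (3/5)^d, which the ratio of the conductances
    compensates. *)
Lemma tops_harmonic : tree_harmonic (conductance n) tops.
Proof.
move=> w i; rewrite -lead_flux_letter -lead_flux_top.
set m := size w; pose d := (n m.+2 - n m.+1)%N.
have dE : n m.+2 = (n m.+1 + d)%N by rewrite subnKC// ltnW.
have d0 : (0 < d)%N by rewrite subn_gt0.
(* [v] is the common prefix after which the two cells at the junction branch off, one by 0 and the
   other by the letter; both have level [n m.+2]. *)
pose v := line_word w ++ nseq (n m.+1 - n m).-1 ord0.
have E1 : v ++ ord0 :: nseq d (letter i) = lead_word w ++ nseq d (letter i).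
  rewrite /v /lead_word -!catA; congr (_ ++ _); rewrite -/m.
  have := n_incr m; rewrite -subn_gt0; case: (n m.+1 - n m)%N => // e _.
  by rewrite -[e.+1 in RHS]addn1 nseqD -catA.
have E2 : v ++ letter i :: nseq d ord0 = lead_word (rcons w i).
  by rewrite /v /lead_word line_word_rcons size_rcons -!catA.
have := above_junction v ord0 (letter i) d isT.
rewrite /junction_flux E1 E2 cell_flux_nseq; last exact: above_lead_word.
move=> /(_ _ _ _ _) J.
have : (3 / 5) ^+ d * cell_flux u (lead_word w) (letter i) +
  cell_flux u (lead_word (rcons w i)) ord0 = 0.
  apply: J.
  - exact/above_cat/above_lead_word.
  - exact: above_lead_word.
  - rewrite -E1; apply/eqP => /(congr1 (fun s => letter i \in s)).
    rewrite mem_cat inE mem_nseq d0 eqxx !orbT mem_nseq.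
    by rewrite [letter i == _](_ : _ = false) ?andbF.
  - by rewrite -E2; exact: cat_neq_nseq.
rewrite /conductance dE exprD => H.
have K : (5 / 3) ^+ d * (3 / 5) ^+ d = 1 :> R.
  by rewrite -exprMn (_ : 5 / 3 * (3 / 5) = 1) ?expr1n//; field.
have -> : cell_flux u (lead_word (rcons w i)) ord0 =
    - ((3 / 5) ^+ d * cell_flux u (lead_word w) (letter i)) by lra.
by rewrite mulrN !mulrA -[_ * _ * (3 / 5) ^+ d]mulrA K mulr1 subrr.
Qed.

(** Once the shrinking cell at the top lies above the line, the power of 5/3 cancels the 3/5 scaling
    and the difference quotients are constant. *)
Lemma top_fluxE w l :
  top_flux x u w (n (size w).+1 - n (size w) + l) = tree_flux (conductance n) tops w.
Proof.
rewrite /top_flux /tree_flux -lead_flux_top !tFE !iter_F -/n.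
set d := (_ - _)%N.
have -> : 2 * u (Fword (line_word w) (q ord0)) -
   u (Fword (line_word w) (Fword (nseq (d + l) ord0) (q (letter letter1)))) -
   u (Fword (line_word w) (Fword (nseq (d + l) ord0) (q (letter letter2)))) =
   cell_flux u (lead_word w ++ nseq l ord0) ord0.
  rewrite (cell_fluxE _ _ _ _ _ (letter_uniq letter1)) rev_letter1 /lead_word -/d.
  by rewrite -catA -nseqD !Fword_cat Fword_nseq_q.
rewrite cell_flux_nseq; last exact: above_lead_word.
rewrite /conductance mulrA addnA subnKC; last exact: ltnW.
rewrite exprD -[X in X * _ = _]mulrA -exprMn (_ : 5 / 3 * (3 / 5) = 1) ?expr1n ?mulr1//.
by field.
Qed.

Lemma lead_corners_eq0 w :
  tops w = 0 -> (forall i, tops (rcons w i) = 0) ->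
  forall l a, u (Fword (lead_word w ++ nseq l ord0) (q a)) = 0.
Proof.
move=> w0 wi0 l a; apply: corners_eq0 => [|{}a]; first exact: above_lead_word.
have := ord3_mem _ _ _ a (letter_uniq letter1); rewrite !inE => /or3P[] /eqP ->.
- by rewrite lead_word_ord0.
- by rewrite lead_word_letter; exact: wi0.
- by rewrite lead_word_letter; exact: wi0.
Qed.

End Harmonic.
End LineCells.

(** * The Cantor set on the line *)

Section CantorSet.
Context {R : realType} (SG : set (plane R)) (gSG : is_gasket SG).
Context (x : R) (x01 : 0 < x < 1) (xnd : nondyadic x).
Let n := expo x.
Let n_incr k : (n k < n k.+1)%N. Proof. exact: expo_incr. Qed.
Implicit Types (u : plane R -> R) (p P : plane R).

Lemma SwP w P : Sw SG x w P <-> Sx SG x P /\ exists2 p, SG p & P = Fword (line_word x w) p.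
Proof.
split=> [[SP [p SGp pP]]|[SP [p SGp PE]]].
  by split => //; exists p => //; rewrite -tFE.
by split => //; exists p => //; rewrite tFE.
Qed.

Lemma Sw_take w k P : Sw SG x w P -> Sw SG x (take k w) P.
Proof.
move=> /SwP[SP [p SGp PE]]; apply/SwP; split => //.
have [v E] := line_word_take x k w.
by exists (Fword v p); [exact: gasket_Fword|rewrite PE E Fword_cat].
Qed.

(* The two children of a cell only meet below the line, at the depth
   [binary_partial n m + 2 ^- n m > x] of their bottom corners. *)
Lemma Sw_inj w w' P : size w = size w' -> Sw SG x w P -> Sw SG x w' P -> w = w'.
Proof.
elim/last_ind: w w' => [|w i IH] w'; first by move=> /esym/size0nil.
elim/last_ind: w' => [|w' j _]; first by rewrite size_rcons.
rewrite !size_rcons => -[sw] Pi Pj.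
have ww' : w = w'.
  apply: IH => //.
    by move: (Sw_take _ (size w) _ Pi); rewrite -cats1 take_size_cat.
  by move: (Sw_take _ (size w') _ Pj); rewrite -cats1 take_size_cat.
rewrite -{w' sw}ww' in Pj *; congr rcons.
have /SwP[[SGP dP] [p SGp PE]] := Pi; have /SwP[_ [p' SGp' PE']] := Pj.
have tp := gasket_triangle SG gSG p SGp; have tp' := gasket_triangle SG gSG p' SGp'.
apply/eqP/negPn/negP => ij; have lij : letter i != letter j.
  by move: ij; have [->|->] := ord2P i; have [->|->] := ord2P j.
have pq : p = q (letter j).
  apply: (F_overlap _ _ _ _ lij tp tp').
  have := PE; rewrite {1}PE' !line_word_rcons !catA !Fword_cat.
  by move=> /Fword_inj /Fword_inj.
have [_ hi] := remainder_bounds x x01 xnd (size w).+1.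
move: dP; rewrite PE depth_line_word// size_rcons pq depthE bary_q mulr0n.
rewrite -/n in hi *; lra.
Qed.

Lemma SwE w v P : (size v <= size w)%N -> Sw SG x w P ->
  (P \in Sw SG x v) = (v == take (size v) w).
Proof.
move=> sv Pw; apply/idP/eqP => [/set_mem Pv|->]; last by apply/mem_set/Sw_take.
by apply: (Sw_inj _ _ P) => //; [rewrite size_takel|exact: Sw_take].
Qed.

(** The depth determines the number of leading zeros in an address: each [F ord0] halves it, and any
    other first letter gives depth at least 1/2. *)
Lemma lead_letter e p : SG p -> 2 ^- e.+1 < depth p < 2 ^- e ->
  exists i p', SG p' /\ p = Fword (nseq e ord0) (F (letter i) p').
Proof.
elim: e p => [|e IH] p SGp; have [c [p' [SGp' pE]]] := gasketE SG gSG p SGp;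
  have tp' := gasket_triangle SG gSG p' SGp';
  have := depth_ge0 p' tp'; have := depth_le1 p' tp';
  have dp : depth p = (depth p' + (c != ord0)%:R) / 2
    by (rewrite pE !depthE bary_F eq_sym; case: eqP => _ /=; rewrite ?mulr1n ?mulr0n; lra).
- rewrite expr1 expr0 invr1; have [c0|c0] := eqVneq c ord0.
    by move: dp {pE}; rewrite {}c0 eqxx mulr0n => ? ? ? /andP[? ?]; exfalso; lra.
  have [i ci] : exists i, c = letter i.
    by case: (unliftP ord0 c) c0 => [i ->|->]; [exists i|rewrite eqxx].
  by move=> _ _ _; exists i, p'; rewrite pE ci.
- have := exp2VS (R := R) e; have := exp2VS (R := R) e.+1 => e2 e1.
  have [c0|c0] := eqVneq c ord0; move: dp.
    rewrite c0 eqxx mulr0n => dp _ _ /andP[lo hi].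
    have [|i [p'' [SGp'' p'E]]] := IH p' SGp'; first by clear pE c0; apply/andP; split; lra.
    by exists i, p''; split => //=; rewrite -p'E pE c0.
  clear pE; rewrite {}c0 mulr1n => dp _ d0 /andP[_ hi].
  have : 2 ^- e.+1 <= 2 ^- 1 :> R by rewrite exp2V_le.
  by rewrite expr1 => ?; exfalso; lra.
Qed.

Lemma Sw_cover m P : Sx SG x P -> exists w, size w = m /\ Sw SG x w P.
Proof.
move=> SP; elim: m => [|m [w [sw /SwP[_ [p SGp PE]]]]].
  by exists [::]; split => //; apply/SwP; split => //; case: SP => ? _; exists P.
pose d := (n m.+1 - n m).-1.
have dn : (n m + d.+1)%N = n m.+1 by have := n_incr m; rewrite /d; lia.
(* The depth of [p] is the m-th remainder of [x] times [2 ^+ n m]; [remainder_bounds] at m and m+1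
   places it strictly between [2 ^- d.+1] and [2 ^- d]. *)
have [|i [p' [SGp' pE]]] := lead_letter d p SGp.
  have [lo hi] := remainder_bounds x x01 xnd m.
  have [lo' hi'] := remainder_bounds x x01 xnd m.+1.
  have dP : 2 ^- n m * depth p = x - binary_partial n m.
    by have [_ <-] := SP; rewrite PE depth_line_word// sw addrAC subrr add0r.
  have e0 := exp2V_gt0 (R := R) (n m).
  have E k : (2 ^- k : R) = 2 ^- (n m + k)%N / 2 ^- n m.
    by rewrite exprD invfM mulrAC mulfV ?mul1r// gt_eqF.
  have dpE : depth p = (x - binary_partial n m) / 2 ^- n m by rewrite -dP mulrAC mulfV ?mul1r// gt_eqF.
  rewrite dpE (E d.+1) (E d) dn !ltr_pM2r ?invr_gt0//; apply/andP; split => //.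
  have := exp2VS (R := R) (n m + d); rewrite -addnS dn => ->.
  move: hi'; rewrite binary_partialS -/n; lra.
exists (rcons w i); rewrite size_rcons sw; split => //; apply/SwP; split => //.
by exists p' => //; rewrite line_word_rcons !Fword_cat/= sw -/d -pE.
Qed.

Lemma haarE om w P : (size om < size w)%N -> Sw SG x w P ->
  haar SG x om P = Num.sqrt (2 ^+ size om) * haar_sign om w.
Proof.
move=> lt Pw; rewrite /haar !indicE !(SwE w) ?size_rcons//.
rewrite !(take_nth letter1 lt) !eqseq_rcons /haar_sign lt /= eq_sym; congr (_ * _).
case: (_ == om) => /=; last by rewrite subrr.
by have [->|->] := ord2P (nth letter1 w (size om)); rewrite ?subr0 ?sub0r.
Qed.

Lemma branch_size W k : branch W -> size (W k) = (size (W 0) + k)%N.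
Proof.
move=> brW; elim: k => [|k IH]; first by rewrite addn0.
by have [i ->] := brW k; rewrite size_rcons IH addnS.
Qed.

Lemma branch_take W k l : branch W -> (k <= l)%N -> W k = take (size (W k)) (W l).
Proof.
move=> brW /subnKC <-; elim: (l - k)%N => [|d IH]; first by rewrite addn0 take_size.
rewrite addnS; have [i ->] := brW (k + d)%N.
by rewrite -cats1 takel_cat// (branch_size W k)// (branch_size W (k + d))// leq_add2l leq_addr.
Qed.

Lemma branch_point W : branch W -> exists P, forall k, Sw SG x (W k) P.
Proof.
move=> brW; pose top k : plane R := Fword (line_word x (W k)) (q ord0).
have cell k l : (k <= l)%N -> (Fword (line_word x (W k)) @` SG) (top l).
  move=> kl; have [v vE] := line_word_take x (size (W k)) (W l).
  exists (Fword v (q ord0)); first by apply: gasket_Fword => //; exact: gasket_q.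
  by rewrite /top vE -(branch_take W) // Fword_cat.
have cSG : compact SG by case: gSG.
have topSG : (top @ \oo) SG.
  by exists 0%N => // k _; apply: gasket_Fword => //; exact: gasket_q.
(* A cluster point of the tops lies in every cell of the branch, the cells being nested and
   closed. *)
have [P [_ clP]] := cSG (top @ \oo) _ topSG.
have PW k : (Fword (line_word x (W k)) @` SG) P.
  apply: (compact_closed (@norm_hausdorff _ _) (cell_compact SG gSG (line_word x (W k)))).
  move=> B nB; apply: clP => //; exists k => // l /= kl; exact: cell.
exists P => k; apply/SwP; split; last first.
  by have [p SGp <-] := PW k; exists p.
split; first by have [p SGp <-] := PW k; exact: gasket_Fword.
(* Both [x] and the depth of [P] lie in the depth range of the l-th cell, whose height is at most
   [2 ^- n l]. *)
have close l : `|x - depth P| <= 2 ^- n l.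
  have [p SGp <-] := PW l; have tp := gasket_triangle SG gSG p SGp.
  rewrite depth_line_word// (branch_size W)//; set m := (_ + l)%N.
  have [lo hi] := remainder_bounds x x01 xnd m; rewrite -/n in lo hi *.
  have e0 := exp2V_gt0 (R := R) (n m); have e1 := exp2V_gt0 (R := R) (n m.+1).
  have lm : 2 ^- n m <= 2 ^- n l :> R by rewrite exp2V_le /m addnC; exact: expo_le.
  have := mulr_ge0 (ltW e0) (depth_ge0 p tp).
  have : 0 <= 2 ^- n m * (1 - depth p).
    by apply: mulr_ge0; [exact: ltW|rewrite subr_ge0 depth_le1].
  by move=> *; rewrite ler_norml; apply/andP; split; lra.
have c0 := exp2V_cvg0 (R := R) n n_incr.
have : `|x - depth P| <= 0.
  rewrite -(cvg_lim _ c0)//; apply: limr_ge; first by apply/cvg_ex; exists 0.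
  by apply: nearW => l; exact: close.
by rewrite normr_le0 subr_eq0 => /eqP.
Qed.

Lemma tops_cvg u W P : {within Omega SG x `|` Sx SG x, continuous u} -> branch W ->
  (forall k, Sw SG x (W k) P) -> tops x u \o W @ \oo --> u P.
Proof.
move=> cu brW PW; apply/cvgrPdist_le => e e0.
have XP : (Omega SG x `|` Sx SG x) P by right; have /SwP[] := PW 0%N.
have kn k : (k <= n k)%N by elim: k => // k /leq_ltn_trans; exact.
have [k|k|N _ HN] := within_cvg_cells _ _ (fun k => line_word x (W k)) P cu XP _ _ e e0.
- by rewrite size_line_word// (branch_size W)// (leq_trans (kn k))// addnC expo_le.
- by have /SwP[_ [p SGp ->]] := PW k; exists p => //; exact: (gasket_triangle SG gSG).
exists N => // k Nk; rewrite /= distrC /tops; apply: HN => //; first exact: triangle_q.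
rewrite -lead_word_ord0; left; apply: (above_lead_word SG gSG x x01 xnd).
by exists (q ord0) => //; exact: gasket_q.
Qed.

End CantorSet.

(** * Normal derivatives *)

Section Assembly.
Context {R : realType} (SG : set (plane R)) (gSG : is_gasket SG).
Context (x : R) (x01 : 0 < x < 1) (xnd : nondyadic x).
Let n := expo x.
Let n_incr k : (n k < n k.+1)%N. Proof. exact: expo_incr. Qed.
Let M : nat -> R := m0_from n.
Let M_bounds k : 0 <= M k <= 3 / 10. Proof. exact: m0_from_bounds. Qed.
Let M_ge0 k : 0 <= M k. Proof. by case/andP: (M_bounds k). Qed.
Let M_ratio : ratio_rel (conductance n) M. Proof. exact: m0_from_ratio. Qed.
Implicit Types (u : plane R -> R) (p P : plane R).

Lemma conductance_gt0 k : 0 < conductance n k :> R.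
Proof. by apply: exprn_gt0; lra. Qed.

Lemma prod_ratio_cvg0 j s : \prod_(j <= l < s + k) M l.+1 @[k --> \oo] --> 0.
Proof.
have c0 : \prod_(j <= l < N) M l.+1 @[N --> \oo] --> (0 : R).
  rewrite -(cvg_shiftn j (fun N => \prod_(j <= l < N) M l.+1)).
  apply: (@squeeze_cvgr _ _ _ _ (cst 0) (fun k => (3 / 10) ^+ k)).
  - apply: nearW => k /=; elim: k => [|k /andP[p0 p1]].
      by rewrite add0n big_geq// expr0 ler01 lexx.
    have /andP[m0 m1] := M_bounds (k + j).+1.
    rewrite addSn big_nat_recr ?leq_addl//= exprSr mulr_ge0//=.
    by apply: ler_pM.
  - exact: cvg_cst.
  - by apply: cvg_expr; rewrite ger0_norm; lra.
rewrite -(cvg_shiftn s (fun N => \prod_(j <= l < N) M l.+1)) in c0.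
by under eq_fun do rewrite addnC.
Qed.

Lemma tops_h0 u : solves_dirichlet SG x 1 (cst 0) u -> tops x u =1 tree_h0 M.
Proof.
move=> [hu cu u0 uS]; apply: (tree_harmonic_uniq _ _ _ conductance_gt0).
- exact: (tops_harmonic SG gSG x x01 xnd _ hu cu).
- exact: tree_h0_harmonic.
- by rewrite /tops/= u0 /tree_h0 big_geq.
move=> W brW; have [P PW] := branch_point SG gSG x x01 xnd W brW.
exists 0.
  have := tops_cvg SG gSG x x01 xnd u W P cu brW PW.
  by rewrite uS//; have /SwP[] := PW 0%N.
have -> : tree_h0 M \o W = (fun k => \prod_(0 <= l < size (W 0%N) + k) M l.+1).
  by apply/funext => k; rewrite /= /tree_h0 (branch_size W).
exact: prod_ratio_cvg0.
Qed.

(** By uniqueness on the tree: along a branch the sign becomes constant and the radial profile tends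
    to 1, so the explicit solution has the limit prescribed at the branch point. *)
Lemma tops_haar om u : solves_dirichlet SG x 0 (haar SG x om) u ->
  tops x u =1 tree_haar M om.
Proof.
move=> [hu cu u0 uS]; apply: (tree_harmonic_uniq _ _ _ conductance_gt0).
- exact: (tops_harmonic SG gSG x x01 xnd _ hu cu).
- exact: tree_haar_harmonic.
- by rewrite /tops/= u0 /tree_haar haar_sign_small// mulr0 mul0r.
move=> W brW; have [P PW] := branch_point SG gSG x x01 xnd W brW.
exists (haar SG x om P).
  have := tops_cvg SG gSG x x01 xnd u W P cu brW PW.
  by rewrite uS//; have /SwP[] := PW 0%N.
have : haar SG x om P * haar_radial M (size om) (size (W 0%N) + k)
    @[k --> \oo] --> haar SG x om P * (1 - 3 * M (size om).+1 / (2 * M (size om).+1 + 1) * 0).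
  apply: cvgM; first exact: cvg_cst.
  apply: cvgB; first exact: cvg_cst.
  by apply: cvgM; [exact: cvg_cst|exact: prod_ratio_cvg0].
rewrite mulr0 subr0 mulr1; apply: cvg_trans; apply: near_eq_cvg.
exists (size om).+1 => // k /= omk.
rewrite /tree_haar (branch_size W k)// (haarE SG gSG x x01 xnd _ (W k))//.
by rewrite (branch_size W k)// (leq_trans omk)// leq_addl.
Qed.

Context (h0 : plane R -> R) (hw : seq 'I_2 -> plane R -> R).
Context (dh0 : solves_dirichlet SG x 1 (cst 0) h0).
Context (dhw : forall w, solves_dirichlet SG x 0 (haar SG x w) (hw w)).
Context (a b : R) (c : seq 'I_2 -> R).

Definition ext_partial (N : nat) p : R :=
  a * h0 p + b * (1 - h0 p) + \sum_(m < N) \sum_(w : m.-tuple 'I_2) c w * hw w p.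

Lemma harmonic_ext_partial N p :
  (forall om, (N <= size om)%N -> hw om p = 0) ->
  harmonic_ext h0 hw a b c p = ext_partial N p.
Proof.
move=> H; congr (_ + _); apply: cvg_lim => //.
rewrite -(cvg_shiftn N (fun N' => \sum_(m < N') \sum_(w : m.-tuple 'I_2) c w * hw w p)).
rewrite (_ : (fun _ => _) = cst (\sum_(m < N) \sum_(w : m.-tuple 'I_2) c w * hw w p)).
  exact: cvg_cst.
apply/funext; elim=> //= k IH; rewrite addSn big_ord_recr/= IH.
rewrite [X in _ + X]big1 ?addr0// => w _; rewrite H ?mulr0//.
by rewrite size_tuple leq_addl.
Qed.

Lemma top_flux_sum (I : finType) (G : I -> plane R -> R) w k :
  top_flux x (fun p => \sum_i G i p) w k = \sum_i top_flux x (G i) w k.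
Proof. by rewrite /top_flux mulr_sumr -!sumrB mulr_sumr. Qed.

Lemma top_flux_ext_partial N w k :
  top_flux x (ext_partial N) w k =
  (a - b) * top_flux x h0 w k +
  \sum_(m < N) \sum_(om : m.-tuple 'I_2) c om * top_flux x (hw om) w k.
Proof.
have -> : \sum_(m < N) \sum_(om : m.-tuple 'I_2) c om * top_flux x (hw om) w k =
    top_flux x (fun p => \sum_(m < N) \sum_(om : m.-tuple 'I_2) c om * hw om p) w k.
  rewrite top_flux_sum; apply: eq_bigr => m _; rewrite top_flux_sum.
  by apply: eq_bigr => om _; rewrite /top_flux; ring.
by rewrite /top_flux /ext_partial; ring.
Qed.

Definition ext_flux w : R :=
  (a - b) * tree_flux (conductance n) (tree_h0 M) w +
  \sum_(m < (size w).+1) \sum_(om : m.-tuple 'I_2)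
    c om * tree_flux (conductance n) (tree_haar M om) w.

Lemma eq_tree_flux (r : nat -> R) (v v' : seq 'I_2 -> R) w :
  v =1 v' -> tree_flux r v w = tree_flux r v' w.
Proof. by move=> vv'; rewrite /tree_flux !vv'. Qed.

Lemma top_flux_ext_cvg w :
  top_flux x (harmonic_ext h0 hw a b c) w @ \oo --> ext_flux w.
Proof.
pose d := (n (size w).+1 - n (size w))%N.
rewrite -(cvg_shiftn d); rewrite (_ : (fun _ => _) = cst (ext_flux w)); first exact: cvg_cst.
apply/funext => l /=.
(* A Haar word longer than [w] gives a function vanishing at the corners of the lead cell of [w],
   hence at the vertices inside it, so the series is a finite sum wherever the difference quotient
   evaluates it. *)
have zero om (i : 'I_3) : (size w < size om)%N ->
    hw om (Fword (lead_word x w ++ nseq l ord0) (q i)) = 0.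
  move=> lt; have [hu cu _ _] := dhw om.
  have T v : (size v <= size om)%N -> tops x (hw om) v = 0.
    by move=> vo; rewrite (tops_haar om)// /tree_haar haar_sign_small// mulr0 mul0r.
  apply: (lead_corners_eq0 SG gSG x x01 xnd _ hu cu); first exact/T/ltnW.
  by move=> j; apply: T; rewrite size_rcons.
have E (i : 'I_3) : Fword (lead_word x w ++ nseq l ord0) (q i) =
    tF x w (iter (l + d) (F ord0) (q i)).
  by rewrite tFE iter_F /lead_word -catA -nseqD Fword_cat addnC.
have -> : top_flux x (harmonic_ext h0 hw a b c) w (l + d) =
    top_flux x (ext_partial (size w).+1) w (l + d).
  rewrite /top_flux -!E !(harmonic_ext_partial (size w).+1) //.
  - by move=> om /zero.
  - by move=> om /zero.
  - by move=> om /(zero om ord0); rewrite E iter_F Fword_nseq_q.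
rewrite top_flux_ext_partial addnC.
rewrite /ext_flux; congr (_ * _ + _).
  have [hu cu _ _] := dh0; rewrite (top_fluxE SG gSG x x01 xnd _ hu cu).
  exact/eq_tree_flux/tops_h0.
apply: eq_bigr => m _; apply: eq_bigr => om _; congr (_ * _).
have [hu cu _ _] := dhw om; rewrite (top_fluxE SG gSG x x01 xnd _ hu cu).
exact/eq_tree_flux/tops_haar.
Qed.

Lemma dn_top_ext w : dn_top x (harmonic_ext h0 hw a b c) w = ext_flux w.
Proof. exact: cvg_lim (top_flux_ext_cvg w). Qed.

Lemma dn_approx_ext m p : Sx SG x p ->
  dn_approx SG x (harmonic_ext h0 hw a b c) m p =
  haar_sum SG x (2 * (b - a) * (5 / 3) ^+ expo x 1 * (1 - m0 x))
    (fun w => dn_multiplier x (size w) * c w) m p.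
Proof.
move=> Sp; have [w [sw pw]] := Sw_cover SG gSG x x01 xnd m p Sp.
(* Among the words of length m only the one whose cell contains [p] contributes. *)
rewrite /dn_approx (bigD1 (Tuple (introT eqP sw)))//= big1 => [|v vw]; last first.
  rewrite indicE (SwE SG gSG x x01 xnd w) ?size_tuple ?sw//.
  by rewrite -[X in take X]sw take_size (_ : (_ == w) = false) ?mulr0//; apply/negbTE.
rewrite addr0 indicE mem_set// mulr1 dn_top_ext /ext_flux sw big_ord_recr/=.
(* Haar words of the same length as [w] give values at its children that cancel, hence no flux;
   exactly the generations below m remain. *)
rewrite [X in _ + (_ + X)]big1 ?addr0 => [|om _]; last first.
  by rewrite tree_haar_flux_small ?mulr0// size_tuple sw.
rewrite /haar_sum mulrN mulrDr opprD; congr (_ + _).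
  have := tree_h0_flux (conductance n) M w M_ratio; rewrite sw => F0.
  rewrite mulrCA F0 (m0_shift x n 0)//= /conductance -/M; ring.
rewrite mulr_sumr -sumrN; apply: eq_bigr => j _.
rewrite mulr_sumr -sumrN; apply: eq_bigr => om _.
have lt : (size om < size w)%N by rewrite size_tuple sw.
have := tree_haar_flux (conductance n) M om w M_ratio M_ge0 lt; rewrite sw => F1.
rewrite mulrCA F1 (haarE SG gSG x x01 xnd _ w)// /dn_multiplier m0_y//.
rewrite /conductance -/n -/M; ring.
Qed.

End Assembly.

Theorem theorem3p3 (R : realType) (SG : set (plane R)) (x : R)
    (mu : probability (plane R) R)
    (h0 : plane R -> R) (hw : seq 'I_2 -> plane R -> R)
    (a b : R) (f : plane R -> R)
    (conv : (nat -> plane R -> R) -> (plane R -> R) -> Prop) :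
  is_gasket SG ->
  0 < x < 1 -> nondyadic x ->
  is_cantor_measure SG x mu ->
  solves_dirichlet SG x 1 (cst 0) h0 ->
  (forall w, solves_dirichlet SG x 0 (haar SG x w) (hw w)) ->
  mu.-integrable (Sx SG x) (EFin \o f) ->
  cvg_ae mu (Sx SG x) (haar_sum SG x b (haar_coef SG x mu f)) f ->
  convergence_mode (Sx SG x) conv ->
  forall g : plane R -> R,
    is_normal_derivative SG x conv
      (harmonic_ext h0 hw a b (haar_coef SG x mu f)) g
    <->
    conv (haar_sum SG x
            (2 * (b - a) * (5 / 3) ^+ expo x 1 * (1 - m0 x))
            (fun w => dn_multiplier x (size w) * haar_coef SG x mu f w)) g.
Proof.
move=> gSG x01 xnd _ dh0 dhw _ _ mode g.
(* The two sequences agree on S(x), so [mode] exchanges them; the limits at the tops exist by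
   [top_flux_ext_cvg]. *)
have E := dn_approx_ext SG gSG x x01 xnd h0 hw dh0 dhw a b (haar_coef SG x mu f).
split=> [[_]|cg]; first by apply: mode => // m p Sp; rewrite E.
split=> [w|].
  apply/cvg_ex; eexists; exact: (top_flux_ext_cvg SG gSG x x01 xnd h0 hw dh0 dhw).
by apply: mode cg => // m p Sp; rewrite E.
Qed.
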